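(* Let $p,k\ge 1$ be integers, and let $\alpha_1,\dots,\alpha_{k+1},\delta\in\mathbb{C}$ satisfy $\Re(\alpha_j)>p-1$ for $j=1,\dots,k+1$ and $\Re(\alpha_{k+1}+\delta)>p-1$. Let $E[\cdot]$ denote the average over the $p\times p$ complex matrix-variate type-1 Dirichlet measure with parameters $(\alpha_1,\dots,\alpha_k;\alpha_{k+1})$, and let $$\phi_2(\tilde X_1,\dots,\tilde X_k)=|\det(I-\tilde X_1-\cdots-\tilde X_k)|^{\delta}.$$ Then $$E[\phi_2]=\frac{\tilde\Gamma_p(\alpha_{k+1}+\delta)}{\tilde\Gamma_p(\alpha_{k+1})}\,\frac{\tilde\Gamma_p(\alpha_1+\cdots+\alpha_{k+1})}{\tilde\Gamma_p(\alpha_1+\cdots+\alpha_{k+1}+\delta)}.$$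
   Context: For Hermitian matrices, $A>O$ means $A$ is positive definite; $I$ is the $p\times p$ identity. For a $p\times p$ Hermitian matrix variable $\tilde X=(x_{ij}+\mathrm{i}\,y_{ij})$, $d\tilde X=\prod_{i\le j}dx_{ij}\prod_{i<j}dy_{ij}$ (Lebesgue measure in the independent real coordinates). $|\det(\cdot)|$ is the absolute value of the determinant. The complex matrix-variate gamma function is $\tilde\Gamma_p(\alpha)=\pi^{p(p-1)/2}\,\Gamma(\alpha)\Gamma(\alpha-1)\cdots\Gamma(\alpha-(p-1))$ for $\Re(\alpha)>p-1$. The complex matrix-variate type-1 Dirichlet measure with parameters $(\alpha_1,\dots,\alpha_k;\alpha_{k+1})$, $\Re(\alpha_j)>p-1$, has density $$f_1(\tilde X_1,\dots,\tilde X_k)=\tilde D_k\left(\prod_{j=1}^k|\det(\tilde X_j)|^{\alpha_j-p}\right)|\det(I-\tilde X_1-\cdots-\tilde X_k)|^{\alpha_{k+1}-p},\qquad \tilde D_k=\frac{\tilde\Gamma_p(\alpha_1+\cdots+\alpha_{k+1})}{\tilde\Gamma_p(\alpha_1)\cdots\tilde\Gamma_p(\alpha_{k+1})},$$ on the set of $k$-tuples of $p\times p$ Hermitian matrices with $\tilde X_j>O$, $I-\tilde X_j>O$ for all $j$, and $I-(\tilde X_1+\cdots+\tilde X_k)>O$; it is zero elsewhere. The Dirichlet average of a function $\phi$ is $E[\phi]=\int \phi\, f_1\,d\tilde X_1\cdots d\tilde X_k$. *)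

(* Defs.v *)
From HB Require Import structures.
From mathcomp Require Import all_boot all_order all_algebra.
From mathcomp Require Import complex.
From mathcomp Require Import all_classical all_reals all_analysis.

Set Implicit Arguments.
Unset Strict Implicit.
Unset Printing Implicit Defensive.
Import Order.TTheory GRing.Theory Num.Theory.
Import numFieldNormedType.Exports.
Local Open Scope classical_set_scope.
Local Open Scope ring_scope.
Local Open Scope sesquilinear_scope.

Section tuple_measure.
Context {R : realType} {d : measure_display} {T : measurableType d}.

Definition tuple_cons n (x : T * n.-tuple T) : n.+1.-tuple T :=
  [tuple of x.1 :: x.2].

Lemma measurable_tuple_cons n : measurable_fun [set: T * n.-tuple T] (@tuple_cons n).
Proof. exact: measurable_cons. Qed.

Section step.
Variables (n : nat) (mu : {sigma_finite_measure set T -> \bar R})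
  (nu : {sigma_finite_measure set (n.-tuple T) -> \bar R}).

Definition cons_measure := pushforward (mu \x nu)%E (@tuple_cons n).

Let pushm := measure_function_pushforward__canonical__measure_function_Measure
  (mu \x nu)%E (@measurable_tuple_cons n).

Let cons_measure0 : cons_measure set0 = 0%E.
Proof. exact: (measure0 pushm). Qed.

Let cons_measure_ge0 A : (0 <= cons_measure A)%E.
Proof. exact: (measure_ge0 pushm). Qed.

Let cons_measure_sigma_additive : semi_sigma_additive cons_measure.
Proof. exact: (@measure_semi_sigma_additive _ _ _ pushm). Qed.

HB.instance Definition _ := isMeasure.Build _ _ _ cons_measure
  cons_measure0 cons_measure_ge0 cons_measure_sigma_additive.

Let cons_measure_sigma_finite : sigma_finite setT cons_measure.
Proof.
have [F FT Foo] : sigma_finite setT (mu \x nu)%E.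
  (* the canonical instance is hidden by the one for subprobabilities *)
  by case: (lebesgue_integral_fubini.measure_function_Measure_isSigmaFinite__to__measure_function_isSigmaFinite mu nu).
pose g := fun t : n.+1.-tuple T => (thead t, [tuple of behead t] : n.-tuple T).
have gK x : g (tuple_cons x) = x.
  case: x => x t; rewrite /g /tuple_cons/= theadE; congr pair.
  exact/val_inj.
have mg : measurable_fun setT g.
  apply/measurable_fun_pair; first exact: measurable_tnth.
  exact: measurable_behead.
exists (fun i => g @^-1` F i); first by rewrite -preimage_bigcup -FT.
move=> i; have [mF Fi] := Foo i; split.
  by rewrite -[_ @^-1` _]setTI; exact: mg.
rewrite /cons_measure /pushforward.
suff -> : @tuple_cons n @^-1` (g @^-1` F i) = F i by [].
by apply/seteqP; split => x /=; rewrite gK.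
Qed.

HB.instance Definition _ := @Measure_isSigmaFinite.Build _ _ _ cons_measure
  cons_measure_sigma_finite.

End step.

(* The n-fold product of mu with itself, as a measure on n-tuples. *)
Fixpoint tuple_measure (mu : {sigma_finite_measure set T -> \bar R}) (n : nat) :
    {sigma_finite_measure set (n.-tuple T) -> \bar R} :=
  match n with
  | 0 => \d_([tuple] : 0.-tuple T)
  | m.+1 => cons_measure mu (tuple_measure mu m)
  end.

End tuple_measure.

Section complex_analysis.
Context {R : realType}.

Definition cintegrable {d} {T : measurableType d} (mu : {measure set T -> \bar R})
    (D : set T) (f : T -> R[i]) : Prop :=
  mu.-integrable D (fun x => (complex.Re (f x))%:E) /\
  mu.-integrable D (fun x => (complex.Im (f x))%:E).

Definition cintegral {d} {T : measurableType d} (mu : {measure set T -> \bar R})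
    (D : set T) (f : T -> R[i]) : R[i] :=
  Complex (\int[mu]_(x in D) complex.Re (f x))
          (\int[mu]_(x in D) complex.Im (f x)).

(* t ^ z = exp (z log t) for real t > 0; not meant for t <= 0. *)
Definition cpowR (t : R) (z : R[i]) : R[i] :=
  let r := expR (complex.Re z * ln t) in
  let theta := complex.Im z * ln t in
  Complex (r * cos theta) (r * sin theta).

(* Euler's integral; it is the Gamma function only for Re z > 0. *)
Definition cGamma (z : R[i]) : R[i] :=
  cintegral lebesgue_measure `]0, +oo[
    (fun t => cpowR t (z - 1) * (expR (- t))%:C%C).

Definition mxGamma (p : nat) (a : R[i]) : R[i] :=
  (pi ^+ (p * p.-1)./2)%:C%C * \prod_(i < p) cGamma (a - i%:R).

End complex_analysis.

Section hermitian_matrices.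
Context {R : realType}.

Definition posdefmx p (A : 'M[R[i]]_p) : Prop :=
  A \is hermsymmx /\
  (forall u : 'rV[R[i]]_p, u != 0 -> 0 < (u *m A *m u ^t*) 0 0).

Definition absdet p (A : 'M[R[i]]_p) : R := Normc.normc (\det A).

(* The p * p real coordinates are indexed by pairs (i, j): for i <= j the
   coordinate (i, j) is x_ij, and for i < j the coordinate (j, i) is y_ij. *)
Definition hermx p (c : (p * p).-tuple (measurableTypeR R)) : 'M[R[i]]_p :=
  let x i j : R := tnth c (mxvec_index i j) in
  \matrix_(i, j)
    if (i < j)%N then Complex (x i j) (x j i)
    else if (j < i)%N then Complex (x j i) (- x i j)
    else Complex (x i i) 0.

Definition herm_lebesgue p :=
  tuple_measure (@lebesgue_measure R) (p * p).

End hermitian_matrices.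

Section dirichlet.
Context {R : realType}.
Variables p k : nat.
Implicit Types (alpha : 'I_k.+1 -> R[i]) (X : 'I_k -> 'M[R[i]]_p).

Definition dirichlet_support X : Prop :=
  (forall j, posdefmx (X j) /\ posdefmx (1%:M - X j)) /\
  posdefmx (1%:M - \sum_j X j).

Definition dirichlet_const alpha : R[i] :=
  mxGamma p (\sum_j alpha j) / \prod_j mxGamma p (alpha j).

(* alpha_1, ..., alpha_k are the values of alpha at widen_ord _ j, j < k, and
   alpha_(k+1) is alpha ord_max. *)
Definition dirichlet_density alpha X : R[i] :=
  if `[< dirichlet_support X >] then
    dirichlet_const alpha *
    (\prod_(j < k) cpowR (absdet (X j)) (alpha (widen_ord (leqnSn k) j) - p%:R)) *
    cpowR (absdet (1%:M - \sum_j X j)) (alpha ord_max - p%:R)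
  else 0.

Definition herm_tuple (c : k.-tuple ((p * p).-tuple (measurableTypeR R))) :
    'I_k -> 'M[R[i]]_p :=
  fun j => hermx (tnth c j).

Definition herm_tuple_lebesgue := tuple_measure (@herm_lebesgue R p) k.

Definition dirichlet_integrable alpha (phi : ('I_k -> 'M[R[i]]_p) -> R[i]) : Prop :=
  cintegrable herm_tuple_lebesgue setT
    (fun c => phi (herm_tuple c) * dirichlet_density alpha (herm_tuple c)).

Definition dirichlet_average alpha (phi : ('I_k -> 'M[R[i]]_p) -> R[i]) : R[i] :=
  cintegral herm_tuple_lebesgue setT
    (fun c => phi (herm_tuple c) * dirichlet_density alpha (herm_tuple c)).

End dirichlet.

(* Main.v *)
Require Import Defs.
From HB Require Import structures.
From mathcomp Require Import all_boot all_order all_algebra.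
From mathcomp Require Import complex.
From mathcomp Require Import all_classical all_reals all_analysis.
From mathcomp Require Import measurable_realfun.
From mathcomp Require Import ring lra.

Set Implicit Arguments.
Unset Strict Implicit.
Unset Printing Implicit Defensive.
Import Order.TTheory GRing.Theory Num.Theory.
Import numFieldNormedType.Exports.
Local Open Scope classical_set_scope.
Local Open Scope ring_scope.

(* On Hermitian [p x p] matrices put [F_a(X) = |det X|^(a - p)] for [X > 0] and
   [F_a(X) = 0] otherwise. Everything follows from the convolution formula
   [F_a * F_b = (Gamma_p(a) Gamma_p(b) / Gamma_p(a + b)) F_(a + b)]: iterating it
   [k] times and evaluating at [I] gives the Dirichlet integral for arbitrary
   exponents, and the factor [phi_2] only replaces [alpha_(k+1)] by
   [alpha_(k+1) + delta].

   The convolution formula is an induction on [p]. With [M / x] the Schur complement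
   of the corner [x], [F_a(M) = x_+^(a - p) F_(a - 1)(M / x)], and for [0 < x < s] the
   Schur complements of [X] and [S - X] add up to that of [S] minus a rank-one matrix
   [w^* w], with [w] affine in the first row of [X]. This leaves a rank-one integral
   [int F_b(T - w^* w) dw], itself computed by Schur complements from planar radial
   integrals, and a scalar beta integral over [x].

   Since [|F_a| = F_(Re a)], each Fubini exchange for complex exponents is justified by
   the same formula at their real parts. Dividing by gamma factors needs that
   [Gamma] has no zero with [Re z > 0]; by the functional equation it is enough to
   treat large [Re z = s], where [t^s e^(-t)] concentrates near [t = s] and
   [cos theta >= 1 - theta^2 / 2] bounds the real part from below. *)

(** * Complex-valued integrals *)

(** The integral formulas hold for every value of their parameters [s], [T], [S]: truncated powers
    make both sides vanish when a pivot is not positive. In the matrix inductions each fibre of a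
    Fubini step is therefore evaluated everywhere, with no exceptional set and no domain of positive
    definite matrices to carry along.

    The exponents fit as follows in size [p + 1]. The pivots enter as [x^(a - p - 1)] and
    [(s - x)^(b - p - 1)], and integrating the first row produces the Jacobian [(x (s - x) / s)^p].
    Its numerator lifts the exponents to those of the scalar beta integral, whose value is a
    multiple of [s^(a + b - 1)]; the remaining [s^(-p)] lowers this to the pivot power that
    [F_(a + b)] requires.

    Analytic estimates are confined to dimension one. There the beta integral is first obtained as a
    number [B] with [B Gamma(a + b) = Gamma(a) Gamma(b)]; solving for [B] is the first use of the
    non-vanishing of [Gamma]. *)

Section complex_lemmas.
Context {R : realType}.
Implicit Types (x y z : R[i]) (r : R).

Lemma cReD x y : complex.Re (x + y) = complex.Re x + complex.Re y.
Proof. by case: x; case: y. Qed.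

Lemma cImD x y : complex.Im (x + y) = complex.Im x + complex.Im y.
Proof. by case: x; case: y. Qed.

Lemma cReN x : complex.Re (- x) = - complex.Re x.
Proof. by case: x. Qed.

Lemma cImN x : complex.Im (- x) = - complex.Im x.
Proof. by case: x. Qed.

Lemma cReM x y : complex.Re (x * y) =
  complex.Re x * complex.Re y - complex.Im x * complex.Im y.
Proof. by case: x; case: y. Qed.

Lemma cImM x y : complex.Im (x * y) =
  complex.Re x * complex.Im y + complex.Im x * complex.Re y.
Proof. by case: x => a b; case: y => c d. Qed.

Lemma cReZ r x : complex.Re (r%:C%C * x) = r * complex.Re x.
Proof. by rewrite cReM/= mul0r subr0. Qed.

Lemma cImZ r x : complex.Im (r%:C%C * x) = r * complex.Im x.
Proof. by rewrite cImM/= mul0r addr0. Qed.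

Lemma complex_ext x y : complex.Re x = complex.Re y ->
  complex.Im x = complex.Im y -> x = y.
Proof. by case: x => a b; case: y => c d /= -> ->. Qed.

Lemma Re_normr_ge0 x : 0 <= complex.Re `|x|.
Proof. by rewrite normc_def /= sqrtr_ge0. Qed.

Lemma le_Re_normr x : `|complex.Re x| <= complex.Re `|x|.
Proof.
rewrite normc_def /= -sqrtr_sqr ler_wsqrtr// lerDl sqr_ge0//.
Qed.

Lemma le_Im_normr x : `|complex.Im x| <= complex.Re `|x|.
Proof.
rewrite normc_def /= -sqrtr_sqr ler_wsqrtr// lerDr sqr_ge0//.
Qed.

(** The real part stays in [R[i]], so that the norm of each kernel is the same kernel at other
    exponents and one lemma serves for a complex integrand and for its norm. *)
Definition rpart z : R[i] := (complex.Re z)%:C%C.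

Lemma rpartD x y : rpart (x + y) = rpart x + rpart y.
Proof. by rewrite /rpart cReD rmorphD. Qed.

Lemma rpartN x : rpart (- x) = - rpart x.
Proof. by rewrite /rpart cReN rmorphN. Qed.

Lemma rpartB x y : rpart (x - y) = rpart x - rpart y.
Proof. by rewrite rpartD rpartN. Qed.

Lemma rpartR r : rpart r%:C%C = r%:C%C. Proof. by []. Qed.

Lemma natrC n : n%:R = (n%:R : R)%:C%C :> R[i].
Proof. by rewrite rmorph_nat. Qed.

Lemma rpart_nat n : rpart n%:R = n%:R.
Proof. by rewrite natrC. Qed.

Lemma Re_nat n : complex.Re (n%:R : R[i]) = n%:R.
Proof. by rewrite natrC. Qed.

Lemma normrC_ge0 r : 0 <= r -> `|r%:C%C| = r%:C%C :> R[i].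
Proof. by move=> r0; rewrite ger0_norm// ler0c. Qed.

End complex_lemmas.

Section complex_measurable.
Context {R : realType} {d : measure_display} {T : measurableType d}.
Implicit Types (f g : T -> R[i]) (r : T -> R).

Definition cmeas f := measurable_fun setT (fun x => complex.Re (f x)) /\
  measurable_fun setT (fun x => complex.Im (f x)).

Lemma cmeas_cst c : cmeas (fun=> c).
Proof. by split; exact: measurable_cst. Qed.

Lemma cmeas_real r : measurable_fun setT r -> cmeas (fun x => (r x)%:C%C).
Proof. by split => //=; exact: measurable_cst. Qed.

Lemma cmeasD f g : cmeas f -> cmeas g -> cmeas (fun x => f x + g x).
Proof.
move=> [f1 f2] [g1 g2]; split.
  by under eq_fun do rewrite cReD; exact: measurable_funD.
by under eq_fun do rewrite cImD; exact: measurable_funD.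
Qed.

Lemma cmeasN f : cmeas f -> cmeas (fun x => - f x).
Proof.
move=> [f1 f2]; split.
  by under eq_fun do rewrite cReN; exact: measurableT_comp.
by under eq_fun do rewrite cImN; exact: measurableT_comp.
Qed.

Lemma cmeasB f g : cmeas f -> cmeas g -> cmeas (fun x => f x - g x).
Proof. by move=> mf mg; apply: cmeasD => //; exact: cmeasN. Qed.

Lemma cmeasM f g : cmeas f -> cmeas g -> cmeas (fun x => f x * g x).
Proof.
move=> [f1 f2] [g1 g2]; split.
  under eq_fun do rewrite cReM.
  by apply: measurable_funB; exact: measurable_funM.
under eq_fun do rewrite cImM.
by apply: measurable_funD; exact: measurable_funM.
Qed.

Lemma cmeas_sum (I : Type) (s : seq I) (F : I -> T -> R[i]) :
  (forall i, cmeas (F i)) -> cmeas (fun x => \sum_(i <- s) F i x).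
Proof.
move=> mF; elim: s => [|i s IH].
  under eq_fun do rewrite big_nil; exact: cmeas_cst.
by under eq_fun do rewrite big_cons; exact: cmeasD.
Qed.

Lemma cmeas_prod (I : Type) (s : seq I) (F : I -> T -> R[i]) :
  (forall i, cmeas (F i)) -> cmeas (fun x => \prod_(i <- s) F i x).
Proof.
move=> mF; elim: s => [|i s IH].
  under eq_fun do rewrite big_nil; exact: cmeas_cst.
by under eq_fun do rewrite big_cons; exact: cmeasM.
Qed.

Lemma cmeas_conj f : cmeas f -> cmeas (fun x => (f x)^*%C).
Proof.
move=> [f1 f2]; split.
  by rewrite (_ : (fun x => _) = fun x => complex.Re (f x))//; apply/funext => x; case: (f x).
rewrite (_ : (fun x => _) = fun x => - complex.Im (f x)).
  exact: measurableT_comp.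
by apply/funext => x; case: (f x).
Qed.

Lemma cmeas_Re f : cmeas f -> measurable_fun setT (fun x => complex.Re (f x)).
Proof. by case. Qed.

Lemma cmeas_norm f : cmeas f ->
  measurable_fun setT (fun x => complex.Re `|f x|).
Proof.
move=> [f1 f2]; under eq_fun do rewrite normc_def/=.
apply: measurableT_comp.
  by apply: continuous_measurable_fun; exact: sqrt_continuous.
by apply: measurable_funD; apply: measurable_funX.
Qed.

Lemma cmeas_ite r f g : measurable_fun setT r -> cmeas f -> cmeas g ->
  cmeas (fun x => if 0 < r x then f x else g x).
Proof.
move=> mr [f1 f2] [g1 g2].
have mb : measurable_fun setT (fun x => 0 < r x).
  exact: measurable_fun_ltr.
split.
- rewrite (_ : (fun x => _) =
    fun x => if 0 < r x then complex.Re (f x) else complex.Re (g x)).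
    exact: measurable_fun_ifT.
  by apply/funext => x; case: ifP.
- rewrite (_ : (fun x => _) =
    fun x => if 0 < r x then complex.Im (f x) else complex.Im (g x)).
    exact: measurable_fun_ifT.
  by apply/funext => x; case: ifP.
Qed.

End complex_measurable.

Lemma cmeas_comp {R : realType} d1 d2 (T1 : measurableType d1)
    (T2 : measurableType d2) (f : T2 -> R[i]) (g : T1 -> T2) :
  cmeas f -> measurable_fun setT g -> cmeas (fun x => f (g x)).
Proof.
move=> [f1 f2] mg; split.
  exact: (measurableT_comp f1 mg).
exact: (measurableT_comp f2 mg).
Qed.

Section has_cint.
Context {R : realType}.

(** Integrability and value travel together: Fubini consumes both at each stage, and the equation
    alone carries no information about a divergent integral. *)
Definition has_cint d (T : measurableType d) (mu : {measure set T -> \bar R})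
    (f : T -> R[i]) (v : R[i]) :=
  cintegrable mu setT f /\ cintegral mu setT f = v.

Section basics.
Context d (T : measurableType d).
Variable mu : {measure set T -> \bar R}.
Implicit Types (f g : T -> R[i]) (v : R[i]).

Lemma has_cint_ext g f v : f =1 g -> has_cint mu g v -> has_cint mu f v.
Proof. by move=> /funext ->. Qed.

Lemma has_cint_uniq f v w : has_cint mu f v -> has_cint mu f w -> v = w.
Proof. by move=> [_ <-] [_ <-]. Qed.

Lemma has_cint_cmeas f v : has_cint mu f v -> cmeas f.
Proof.
by move=> [[/measurable_int/measurable_EFinP ? /measurable_int/measurable_EFinP ?] _]; split.
Qed.

Lemma has_cintE f v : has_cint mu f v <->
  [/\ mu.-integrable setT (fun x => (complex.Re (f x))%:E),
      mu.-integrable setT (fun x => (complex.Im (f x))%:E),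
      (\int[mu]_x (complex.Re (f x))%:E = (complex.Re v)%:E)%E &
      (\int[mu]_x (complex.Im (f x))%:E = (complex.Im v)%:E)%E].
Proof.
split=> [[[f1 f2] <-]|[f1 f2 e1 e2]].
  split => //=; rewrite /Rintegral fineK//.
    exact: integrable_fin_num.
  exact: integrable_fin_num.
split; first by split.
by apply: complex_ext => /=; rewrite /Rintegral ?e1 ?e2.
Qed.

Lemma cintegrable_norm f : cmeas f ->
  (\int[mu]_x (complex.Re `|f x|)%:E < +oo)%E -> cintegrable mu setT f.
Proof.
move=> mf foo; have mn := cmeas_norm mf.
have [m1 m2] := mf.
have intn : mu.-integrable setT (fun x => (complex.Re `|f x|)%:E).
  apply/integrableP; split; first exact/measurable_EFinP.
  by under eq_integral do rewrite gee0_abs ?lee_fin ?Re_normr_ge0//.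
split.
- apply: (le_integrable measurableT _ _ intn); first exact/measurable_EFinP.
  move=> x _ /=; rewrite lee_fin [leRHS]ger0_norm ?Re_normr_ge0//.
  exact: le_Re_normr.
- apply: (le_integrable measurableT _ _ intn); first exact/measurable_EFinP.
  move=> x _ /=; rewrite lee_fin [leRHS]ger0_norm ?Re_normr_ge0//.
  exact: le_Im_normr.
Qed.

Lemma has_cint_scale c f v : has_cint mu f v ->
  has_cint mu (fun x => c * f x) (c * v).
Proof.
move=> /has_cintE[f1 f2 e1 e2]; apply/has_cintE.
have i1 a : mu.-integrable setT (fun x => (a * complex.Re (f x))%:E).
  by under eq_fun do rewrite EFinM; exact: integrableZl.
have i2 a : mu.-integrable setT (fun x => (a * complex.Im (f x))%:E).
  by under eq_fun do rewrite EFinM; exact: integrableZl.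
have E1 a : (\int[mu]_x (a * complex.Re (f x))%:E = (a * complex.Re v)%:E)%E.
  by under eq_integral do rewrite EFinM; rewrite integralZl// e1.
have E2 a : (\int[mu]_x (a * complex.Im (f x))%:E = (a * complex.Im v)%:E)%E.
  by under eq_integral do rewrite EFinM; rewrite integralZl// e2.
split.
- under eq_fun do rewrite cReM EFinB; exact: integrableB.
- under eq_fun do rewrite cImM EFinD; exact: integrableD.
- under eq_integral do rewrite cReM EFinB.
  by rewrite integralB// E1 E2 cReM EFinB.
- under eq_integral do rewrite cImM EFinD.
  by rewrite integralD// E1 E2 cImM EFinD.
Qed.

Lemma has_cint_scaler c f v : has_cint mu f v ->
  has_cint mu (fun x => f x * c) (v * c).
Proof.
move=> fv; rewrite mulrC; apply: (has_cint_ext (g := fun x => c * f x)).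
  by move=> x; rewrite mulrC.
exact: has_cint_scale.
Qed.

Lemma has_cint0 : has_cint mu (fun=> 0) 0.
Proof.
by apply/has_cintE; split; rewrite /= ?integral0//; exact: integrable0.
Qed.

Lemma has_cintD f g v w : has_cint mu f v -> has_cint mu g w ->
  has_cint mu (fun x => f x + g x) (v + w).
Proof.
move=> /has_cintE[f1 f2 e1 e2] /has_cintE[g1 g2 h1 h2]; apply/has_cintE; split.
- under eq_fun do rewrite cReD EFinD; exact: integrableD.
- under eq_fun do rewrite cImD EFinD; exact: integrableD.
- by under eq_integral do rewrite cReD EFinD; rewrite integralD// e1 h1 cReD EFinD.
- by under eq_integral do rewrite cImD EFinD; rewrite integralD// e2 h2 cImD EFinD.
Qed.

Lemma has_cintB f g v w : has_cint mu f v -> has_cint mu g w ->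
  has_cint mu (fun x => f x - g x) (v - w).
Proof.
move=> hf /(has_cint_scale (-1)) hg; rewrite -mulN1r.
apply: (has_cint_ext (g := fun x => f x + -1 * g x)).
  by move=> x; rewrite mulN1r.
exact: has_cintD.
Qed.

End basics.

(** * Maps that push one measure to a multiple of another *)

Section change_of_variables.
Context d1 d2 (T1 : measurableType d1) (T2 : measurableType d2).
Variables (mu : {measure set T1 -> \bar R}) (nu : {measure set T2 -> \bar R}).
Variables (phi : T1 -> T2) (mphi : measurable_fun setT phi).
Variables (k : R) (k0 : 0 < k).
Hypothesis phiE : forall A, measurable A -> mu (phi @^-1` A) = (k%:E * nu A)%E.

Let ge0_integral_phi (f : T2 -> \bar R) : measurable_fun setT f ->
  (forall x, 0 <= f x)%E -> (\int[mu]_x f (phi x) = k%:E * \int[nu]_x f x)%E.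
Proof.
move=> mf f0.
transitivity (\int[mscale (NngNum (ltW k0)) nu]_x f x)%E; last first.
  by rewrite ge0_integral_mscale.
pose pm : {measure set T2 -> \bar R} :=
  measure_function_pushforward__canonical__measure_function_Measure mu mphi.
transitivity (\int[pm]_x f x)%E; last first.
  apply: eq_measure_integral => A mA _.
  by rewrite /mscale/= /pushforward/= phiE.
by rewrite [RHS](ge0_integral_pushforward mphi mu measurableT).
Qed.

Lemma integrable_image (f : T2 -> R) : measurable_fun setT f ->
  mu.-integrable setT (fun x => (f (phi x))%:E) <->
  nu.-integrable setT (fun x => (f x)%:E).
Proof.
move=> mf.
have me : measurable_fun setT (fun x => (f x)%:E) by exact/measurable_EFinP.
have E := @ge0_integral_phi (fun x => `|(f x)%:E|%E)
   (measurableT_comp (@abse_measurable _ _) me) (fun=> abse_ge0 _).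
split=> /integrableP[m1 foo]; apply/integrableP; split => //.
- move: foo; rewrite E => foo.
  rewrite ltNge leye_eq; apply/negP => /eqP h; move: foo.
  by rewrite h gt0_muley ?lte_fin// ltxx.
- exact: (measurableT_comp me mphi).
- by rewrite E lte_mul_pinfty ?lee_fin ?(ltW k0)//.
Qed.

Lemma integral_image (f : T2 -> R) :
  nu.-integrable setT (fun x => (f x)%:E) ->
  (\int[mu]_x (f (phi x))%:E = k%:E * \int[nu]_x (f x)%:E)%E.
Proof.
move=> intf; have mf := measurable_int _ intf.
have fp : (\int[nu]_x (EFin \o f)^\+ x)%E \is a fin_num.
  exact: (integrable_fin_num measurableT (integrable_funepos measurableT intf)).
have fn : (\int[nu]_x (EFin \o f)^\- x)%E \is a fin_num.
  exact: (integrable_fin_num measurableT (integrable_funeneg measurableT intf)).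
rewrite integralE [in RHS]integralE.
rewrite (_ : (fun x => (f (phi x))%:E) = (EFin \o f) \o phi)//.
rewrite funepos_comp funeneg_comp.
rewrite (_ : (fun x => (f x)%:E) = EFin \o f)//.
have -> := @ge0_integral_phi _ (measurable_funepos mf) (fun=> funepos_ge0 _ _).
have -> := @ge0_integral_phi _ (measurable_funeneg mf) (fun=> funeneg_ge0 _ _).
by apply/esym; apply: muleBr => //; exact: fin_num_adde_defr.
Qed.

Lemma has_cint_image (f : T2 -> R[i]) v : has_cint nu f v ->
  has_cint mu (fun x => f (phi x)) (k%:C%C * v).
Proof.
move=> fv; have [m1 m2] := has_cint_cmeas fv.
move/has_cintE: fv => [f1 f2 e1 e2]; apply/has_cintE; split.
- by apply/(integrable_image m1).
- by apply/(integrable_image m2).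
- by rewrite (integral_image f1) e1 cReM/= mul0r subr0 EFinM.
- by rewrite (integral_image f2) e2 cImM/= mul0r addr0 EFinM.
Qed.

(** Carries an integral computed by Fubini on a product space down to the space of tuples that the
    product parametrizes. *)
Lemma has_cint_preimage (f : T2 -> R[i]) v : cmeas f ->
  has_cint mu (fun x => f (phi x)) v -> has_cint nu f (k^-1%:C%C * v).
Proof.
move=> [m1 m2] fv.
have /has_cint_image : has_cint nu f (cintegral nu setT f).
  case: fv => -[/(integrable_image m1) i1 /(integrable_image m2) i2] _.
  by split.
move=> fv'; move: (fv') => /(has_cint_uniq fv) ->.
rewrite mulrA -rmorphM/= mulVf ?gt_eqF// mul1r.
case: fv => -[/(integrable_image m1) i1 /(integrable_image m2) i2] _.
by split.
Qed.

End change_of_variables.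

(** * Fubini for complex integrands *)

Section fubini.
Context d1 d2 (T1 : measurableType d1) (T2 : measurableType d2).
Variables (m1 : {sigma_finite_measure set T1 -> \bar R})
          (m2 : {sigma_finite_measure set T2 -> \bar R}).

(** [G] and [V] supply the Tonelli bound. In the applications with complex exponents they are [g]
    and [v] with the exponents replaced by their real parts, so the same computation is used
    twice. *)
Lemma has_cint_fubini (f : T1 * T2 -> R[i]) (g G : T1 -> R[i]) v V :
  cmeas f ->
  (forall x, has_cint m2 (fun y => f (x, y)) (g x)) ->
  (forall x, has_cint m2 (fun y => `|f (x, y)|) (G x)) ->
  has_cint m1 g v -> has_cint m1 G V ->
  has_cint (m1 \x m2)%E f v.
Proof.
move=> mf fg fG /has_cintE[g1 g2 eg1 eg2] /has_cintE[G1 _ eG1 _].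
have mn := cmeas_norm mf.
have [mf1 mf2] := mf.
have [i1 i2] : cintegrable (m1 \x m2)%E setT f.
  apply: cintegrable_norm => //.
  rewrite fubini_tonelli1//=; last 2 first.
  - exact/measurable_EFinP.
  - by move=> x; rewrite lee_fin Re_normr_ge0.
  rewrite /fubini_F.
  under eq_integral.
    move=> x _; have /has_cintE[_ _ -> _] := fG x.
    over.
  by rewrite eG1 ltry.
apply/has_cintE; split => //.
- rewrite -integral12_prod_meas1//= -eg1; apply: eq_integral => x _.
  by have /has_cintE[_ _ <- _] := fg x.
- rewrite -integral12_prod_meas1//= -eg2; apply: eq_integral => x _.
  by have /has_cintE[_ _ _ <-] := fg x.
Qed.

Lemma integrable_fubini_G (f : T1 * T2 -> \bar R) :
  (m1 \x m2)%E.-integrable setT f -> m2.-integrable setT (fubini_G m1 f).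
Proof.
move=> intf; have mf : measurable_fun setT f := measurable_int _ intf.
have mG : measurable_fun setT (fun y => \int[m1]_x `|f (x, y)|)%E.
  apply: (measurable_fun_fubini_tonelli_G (abse \o f)) => //=.
  exact: measurableT_comp.
apply/integrableP; split; first exact: (measurable_fubini_G intf).
have H := (integrable21ltyP m1 m2 mf).1 intf; apply: le_lt_trans H.
apply: ge0_le_integral => //.
- by apply: measurableT_comp => //; exact: (measurable_fubini_G intf).
- move=> y _; apply: le_abse_integral => //.
  exact: measurableT_comp.
Qed.

(** The opposite order of integration: the joint integral is already known, and the integrability of
    [g] is deduced from it. *)
Lemma has_cint_fubini2 (f : T1 * T2 -> R[i]) (g : T2 -> R[i]) v :
  has_cint (m1 \x m2)%E f v ->
  (forall y, has_cint m1 (fun x => f (x, y)) (g y)) ->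
  has_cint m2 g v.
Proof.
move=> /has_cintE[i1 i2 e1 e2] fg.
have E1 : (fun y => (complex.Re (g y))%:E) =
    fubini_G m1 (fun z => (complex.Re (f z))%:E).
  by apply/funext => y; rewrite /fubini_G; have /has_cintE[_ _ -> _] := fg y.
have E2 : (fun y => (complex.Im (g y))%:E) =
    fubini_G m1 (fun z => (complex.Im (f z))%:E).
  by apply/funext => y; rewrite /fubini_G; have /has_cintE[_ _ _ ->] := fg y.
apply/has_cintE; rewrite E1 E2 -e1 -e2; split.
- exact: integrable_fubini_G.
- exact: integrable_fubini_G.
- exact: integral21_prod_meas1.
- exact: integral21_prod_meas1.
Qed.

End fubini.

End has_cint.

(** * Complex powers of a positive real and their truncation *)

Section powers.
Context {R : realType}.
Implicit Types (a b z : R[i]) (s t : R).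

Lemma cpowRD t a b : cpowR t (a + b) = cpowR t a * cpowR t b.
Proof.
rewrite /cpowR cReD cImD !mulrDl expRD cosD sinD.
by apply: complex_ext; rewrite ?cReM ?cImM /=; ring.
Qed.

Lemma cpowRM s t a : 0 < s -> 0 < t -> cpowR (s * t) a = cpowR s a * cpowR t a.
Proof.
move=> s0 t0; rewrite /cpowR lnM ?posrE// !mulrDr expRD cosD sinD.
by apply: complex_ext; rewrite ?cReM ?cImM /=; ring.
Qed.

Lemma cpowR0 t : cpowR t 0 = 1 :> R[i].
Proof. by rewrite /cpowR !mul0r expR0 cos0 sin0 mulr1 mulr0. Qed.

Lemma cpowR1 a : cpowR 1 a = 1.
Proof. by rewrite /cpowR ln1 !mulr0 expR0 cos0 sin0 mulr1 mulr0. Qed.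

Lemma cpowR_neq0 t a : cpowR t a != 0.
Proof.
apply/negP => /eqP h; have := cpowRD t a (- a).
by rewrite h mul0r subrr cpowR0 => /eqP; rewrite oner_eq0.
Qed.

Lemma cpowRN t a : cpowR t (- a) = (cpowR t a)^-1.
Proof.
apply: (mulfI (cpowR_neq0 t a)).
by rewrite -cpowRD subrr cpowR0 divff// cpowR_neq0.
Qed.

Lemma cpowRB t a b : cpowR t (a - b) = cpowR t a / cpowR t b.
Proof. by rewrite cpowRD cpowRN. Qed.

Lemma cpowR_id t : 0 < t -> cpowR t 1 = t%:C%C.
Proof.
by move=> t0; rewrite /cpowR /= mul1r !mul0r cos0 sin0 mulr1 mulr0 lnK.
Qed.

Lemma cpowR_nat t n : 0 < t -> cpowR t n%:R = t%:C%C ^+ n.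
Proof.
move=> t0; elim: n => [|n IH]; first by rewrite expr0 cpowR0.
by rewrite -natr1 cpowRD IH cpowR_id// exprSr.
Qed.

Lemma normr_cpowR t a : `|cpowR t a| = cpowR t (rpart a).
Proof.
rewrite normc_def /cpowR /= mul0r cos0 sin0 mulr1 mulr0.
apply/complex_ext => //=.
rewrite !exprMn -mulrDr cos2Dsin2 mulr1 sqrtr_sqr ger0_norm// expR_ge0.
Qed.

Lemma Re_cpowR_rpart t a : 0 < t -> complex.Re (cpowR t (rpart a)) = t `^ (complex.Re a).
Proof.
by move=> t0; rewrite /cpowR /= mul0r cos0 mulr1 /powR gt_eqF.
Qed.

(** The case [p = 1] of [F_a]. With the exponent [a - 1], convolution adds the parameters; [hpow 1]
    is the indicator of the positive half-line. *)
Definition hpow a t := if 0 < t then cpowR t (a - 1) else 0.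

Lemma hpow_gt0 a t : 0 < t -> hpow a t = cpowR t (a - 1).
Proof. by rewrite /hpow => ->. Qed.

Lemma hpow_le0 a t : t <= 0 -> hpow a t = 0.
Proof. by rewrite /hpow ltNge => ->. Qed.

Lemma hpowZ a s t : 0 < s -> hpow a (s * t) = cpowR s (a - 1) * hpow a t.
Proof.
move=> s0; rewrite /hpow pmulr_rgt0//; case: ifPn => t0; last by rewrite mulr0.
by rewrite cpowRM.
Qed.

Lemma normr_hpow a t : `|hpow a t| = hpow (rpart a) t.
Proof.
rewrite /hpow; case: ifPn => t0; last by rewrite normr0.
by rewrite normr_cpowR rpartB rpartR.
Qed.

Lemma hpowM a b t : hpow a t * cpowR t b = hpow (a + b) t.
Proof.
by rewrite /hpow; case: ifPn => _; [rewrite -cpowRD addrAC|rewrite mul0r].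
Qed.

Lemma measurable_cpowR_Re a : measurable_fun setT (fun t => complex.Re (cpowR t a)).
Proof.
apply: measurable_funM => /=.
  apply: measurableT_comp => //; apply: measurable_funM => //.
apply: measurableT_comp; first exact: (continuous_measurable_fun (@continuous_cos R)).
exact: measurable_funM.
Qed.

Lemma measurable_cpowR_Im a : measurable_fun setT (fun t => complex.Im (cpowR t a)).
Proof.
apply: measurable_funM => /=.
  apply: measurableT_comp => //; apply: measurable_funM => //.
apply: measurableT_comp; first exact: (continuous_measurable_fun (@continuous_sin R)).
exact: measurable_funM.
Qed.

Lemma cmeas_cpowR a : cmeas (fun t : measurableTypeR R => cpowR t a).
Proof.
by split; [exact: measurable_cpowR_Re|exact: measurable_cpowR_Im].
Qed.

Lemma cmeas_hpow a : cmeas (hpow a : measurableTypeR R -> R[i]).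
Proof.
apply: cmeas_ite; first exact: measurable_id.
  exact: cmeas_cpowR.
exact: cmeas_cst.
Qed.

End powers.

(** * Affine substitutions on the real line *)

Section lebesgue_affine.
Context {R : realType}.
Local Notation leb := (@lebesgue_measure R).
Implicit Types (c b s : R) (f : measurableTypeR R -> R[i]).

Lemma lebesgue_affine c b (A : set (measurableTypeR R)) : 0 < c ->
  measurable A -> leb ((fun t : measurableTypeR R => c * t + b) @^-1` A) = (c^-1%:E * leb A)%E.
Proof.
move=> c0 mA.
have mphi : measurable_fun setT (fun t : measurableTypeR R => c * t + b : measurableTypeR R).
  by apply: measurable_funD => //; exact: measurable_funM.
pose pm : {measure set (measurableTypeR R) -> \bar R} :=
  measure_function_pushforward__canonical__measure_function_Measure leb mphi.
have -> : leb A = mscale (NngNum (ltW c0)) pm A.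
  apply: lebesgue_measure_unique => // _ [[x y] /= _ <-].
  rewrite /mscale/= /pushforward/=.
  rewrite (_ : _ @^-1` _ = `]((x - b) / c), ((y - b) / c)]%classic); last first.
    by apply/seteqP; split=> t /=; rewrite !in_itv/= ltr_pdivrMr// ler_pdivlMr//
      (mulrC t) ltrBlDr lerBrDr.
  rewrite lebesgue_measure_itv/= lebesgue_measure_itv/= !lte_fin.
  rewrite ltr_pM2r ?invr_gt0// ltrD2r; case: ifP => _; last by rewrite mule0.
  rewrite -EFinB -EFinM; congr EFin.
  by rewrite -mulrBl mulrC divfK ?gt_eqF//; ring.
by rewrite /mscale/= muleA -EFinM mulVf ?gt_eqF// mul1e.
Qed.

Lemma has_cint_affine c b f v : 0 < c -> has_cint leb f v ->
  has_cint leb (fun t => f (c * t + b)) (c^-1%:C%C * v).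
Proof.
move=> c0 fv.
apply: (@has_cint_image _ _ _ _ _ leb leb (fun t => c * t + b)) => //.
- by apply: measurable_funD => //; exact: measurable_funM.
- by rewrite invr_gt0.
- by move=> A mA; exact: lebesgue_affine.
Qed.

Lemma has_cint_refl s f v : has_cint leb f v ->
  has_cint leb (fun t => f (s - t)) v.
Proof.
move=> fv.
have : has_cint leb (fun t => f (- t)) (1%:C%C * v).
  apply: (@has_cint_image _ _ _ _ _ leb leb -%R) => //.
  by move=> A mA; rewrite mul1e -[RHS]lebesgue_measureN.
move=> /(has_cint_affine (- s) ltr01); rewrite invr1 !mul1r.
by apply: has_cint_ext => t; congr f; ring.
Qed.

Lemma has_cint_translate s f v : has_cint leb f v ->
  has_cint leb (fun t => f (t - s)) v.
Proof.
move=> /(has_cint_affine (- s) ltr01); rewrite invr1 !mul1r.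
by apply: has_cint_ext => t; congr f; ring.
Qed.

End lebesgue_affine.

(** * Scalar beta and gamma integrals *)

Section power_integral.
Context {R : realType}.
Local Notation leb := (@lebesgue_measure R).
Implicit Types (z : R[i]) (u : R).

Lemma is_derive_cpowR z (t : R) : 0 < t ->
  is_derive t 1 (fun t => complex.Re (cpowR t z)) (complex.Re (z * cpowR t (z - 1))) /\
  is_derive t 1 (fun t => complex.Im (cpowR t z)) (complex.Im (z * cpowR t (z - 1))).
Proof.
move=> t0.
have d a : is_derive t 1 (fun t : R => a * ln t) (a / t).
  have := is_derive1_ln t0 => dl.
  exact: is_deriveZ.
have d1 := @is_derive1_comp R _ _ _ _ _ (is_derive_expR _) (d (complex.Re z)).
have d2 := @is_derive1_comp R _ _ _ _ _ (is_derive_cos _) (d (complex.Im z)).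
have d3 := @is_derive1_comp R _ _ _ _ _ (is_derive_sin _) (d (complex.Im z)).
have t1 : t * t^-1 = 1 by rewrite mulfV ?gt_eqF.
have tV : (t%:C%C)^-1 = (t^-1)%:C%C :> R[i] by rewrite fmorphV.
split.
- have := @is_deriveM R _ _ _ _ _ _ _ d1 d2 => d12; refine (is_derive_eq d12 _).
  rewrite cpowRB cpowR_id// tV !cReM /= /GRing.scale/= ?cImM/=; ring.
- have := @is_deriveM R _ _ _ _ _ _ _ d1 d3 => d13; refine (is_derive_eq d13 _).
  rewrite cpowRB cpowR_id// tV !cImM /= /GRing.scale/= ?cReM/=; ring.
Qed.

Lemma continuous_cpowR z (t : R) : 0 < t ->
  {for t, continuous (fun t => complex.Re (cpowR t z))} /\
  {for t, continuous (fun t => complex.Im (cpowR t z))}.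
Proof.
move=> t0; have [d1 d2] := is_derive_cpowR z t0.
split; apply: differentiable_continuous; apply/derivable1_diffP.
  by case: d1.
by case: d2.
Qed.

Lemma continuousM_cpowR c z (t : R) : 0 < t ->
  {for t, continuous (fun t => complex.Re (c * cpowR t z))} /\
  {for t, continuous (fun t => complex.Im (c * cpowR t z))}.
Proof.
move=> t0; have [c1 c2] := continuous_cpowR z t0; split.
  rewrite (_ : (fun t => _) = fun t => complex.Re c * complex.Re (cpowR t z)
     - complex.Im c * complex.Im (cpowR t z)); last by apply/funext => x; rewrite cReM.
  by apply: continuousB; apply: continuousM => //; exact: cvg_cst.
rewrite (_ : (fun t => _) = fun t => complex.Re c * complex.Im (cpowR t z)
     + complex.Im c * complex.Re (cpowR t z)); last by apply/funext => x; rewrite cImM.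
by apply: continuousD; apply: continuousM => //; exact: cvg_cst.
Qed.

Lemma integral_cpowR z u : 0 < u < 1 ->
  (\int[leb]_(t in `[u, 1%R]) (complex.Re (z * cpowR t (z - 1)))%:E =
     (complex.Re (1 - cpowR u z))%:E)%E /\
  (\int[leb]_(t in `[u, 1%R]) (complex.Im (z * cpowR t (z - 1)))%:E =
     (complex.Im (1 - cpowR u z))%:E)%E.
Proof.
move=> /andP[u0 u1].
have pos t : t \in `]u, 1[ -> 0 < t by rewrite in_itv/= => /andP[/(lt_trans u0)].
have posc (t : R) : `[u, 1]%classic t -> 0 < t.
  by rewrite /= in_itv/= => /andP[/(lt_le_trans u0)].
split.
- rewrite (@continuous_FTC2 R (fun t => complex.Re (z * cpowR t (z - 1)))
    (fun t => complex.Re (cpowR t z)))//.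
  + by rewrite cpowR1 cReD cReN EFinB.
  + apply: continuous_in_subspaceT => t; rewrite inE => /posc t0.
    by have [] := continuousM_cpowR z (z - 1) t0.
  + split.
    * by move=> t /pos t0; have [[]] := is_derive_cpowR z t0.
    * by apply: cvg_at_right_filter; have [] := continuous_cpowR z u0.
    * by apply: cvg_at_left_filter; have [] := continuous_cpowR z (@ltr01 R).
  + move=> t /pos t0; rewrite derive1E; have [d _] := is_derive_cpowR z t0.
    exact: derive_val.
- rewrite (@continuous_FTC2 R (fun t => complex.Im (z * cpowR t (z - 1)))
    (fun t => complex.Im (cpowR t z)))//.
  + by rewrite cpowR1 cImD cImN EFinB.
  + apply: continuous_in_subspaceT => t; rewrite inE => /posc t0.
    by have [] := continuousM_cpowR z (z - 1) t0.
  + split.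
    * by move=> t /pos t0; have [_ []] := is_derive_cpowR z t0.
    * by apply: cvg_at_right_filter; have [] := continuous_cpowR z u0.
    * by apply: cvg_at_left_filter; have [] := continuous_cpowR z (@ltr01 R).
  + move=> t /pos t0; rewrite derive1E; have [_ d] := is_derive_cpowR z t0.
    exact: derive_val.
Qed.

(** The fundamental theorem of calculus on [[u, 1[]. The indicator of that interval is written as a
    difference of cut-offs at [1] and at [u], two kernels related by scaling. *)
Lemma has_cint_cpowR_itv z u : 0 < u < 1 ->
  has_cint leb (fun t => z * (hpow z t * hpow 1 (1 - t)) - z * (hpow z t * hpow 1 (u - t)))
    (1 - cpowR u z).
Proof.
move=> u01; have /andP[u0 u1] := u01.
have [E1 E2] := integral_cpowR z u01.
have posc (t : R) : `[u, 1]%classic t -> 0 < t.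
  by rewrite /= in_itv/= => /andP[/(lt_le_trans u0)].
have I1 : leb.-integrable `[u, 1] (fun t => (complex.Re (z * cpowR t (z - 1)))%:E).
  apply: continuous_compact_integrable; first exact: segment_compact.
  apply: continuous_in_subspaceT => t; rewrite inE => /posc t0.
  by have [] := continuousM_cpowR z (z - 1) t0.
have I2 : leb.-integrable `[u, 1] (fun t => (complex.Im (z * cpowR t (z - 1)))%:E).
  apply: continuous_compact_integrable; first exact: segment_compact.
  apply: continuous_in_subspaceT => t; rewrite inE => /posc t0.
  by have [] := continuousM_cpowR z (z - 1) t0.
have sub : (`[u, 1[%classic : set (measurableTypeR R)) `<=` `[u, 1]%classic.
  by apply: subset_itvl; rewrite bnd_simp.
have J1 : leb.-integrable `[u, 1[ (fun t => (complex.Re (z * cpowR t (z - 1)))%:E).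
  by apply: (integrableS _ _ sub I1).
have J2 : leb.-integrable `[u, 1[ (fun t => (complex.Im (z * cpowR t (z - 1)))%:E).
  by apply: (integrableS _ _ sub I2).
have fE t : z * (hpow z t * hpow 1 (1 - t)) - z * (hpow z t * hpow 1 (u - t)) =
    if t \in `[u, 1[ then z * cpowR t (z - 1) else 0.
  rewrite /hpow !subr_gt0 subrr !cpowR0 in_itv/=.
  have [t0|t0] := ltP 0 t; last first.
    by rewrite !mul0r mulr0 subrr leNgt (le_lt_trans t0 u0).
  have [ut|tu] := leP u t; first by rewrite !mulr0 subr0; case: ifP; rewrite ?mulr1 ?mulr0.
  by rewrite (lt_trans tu u1) subrr.
apply/has_cintE; split.
- move/integrable_mkcond : J1 => /(_ (measurable_itv _)).
  apply: eq_integrable => // t _; rewrite patchE fE mem_setE.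
  by case: ifP.
- move/integrable_mkcond : J2 => /(_ (measurable_itv _)).
  apply: eq_integrable => // t _; rewrite patchE fE mem_setE.
  by case: ifP.
- rewrite -E1 -integral_itv_bndo_bndc; last exact: measurable_int _ J1.
  rewrite [RHS]integral_mkcond; apply: eq_integral => t _.
  by rewrite patchE fE mem_setE; case: ifP.
- rewrite -E2 -integral_itv_bndo_bndc; last exact: measurable_int _ J2.
  rewrite [RHS]integral_mkcond; apply: eq_integral => t _.
  by rewrite patchE fE mem_setE; case: ifP.
Qed.

(** The integrand of the convolution of two truncated powers at [s]; for [s = 1] it is the beta
    integrand. *)
Definition bker (a b : R[i]) (s t : R) : R[i] := hpow a t * hpow b (s - t).

Lemma cmeas_bker a b s : cmeas (bker a b s : measurableTypeR R -> R[i]).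
Proof.
apply: cmeasM; first exact: cmeas_hpow.
apply: (cmeas_comp (cmeas_hpow b)).
exact: measurable_funB.
Qed.

Lemma normr_bker a b s t : `|bker a b s t| = bker (rpart a) (rpart b) s t.
Proof. by rewrite /bker normrM !normr_hpow. Qed.

Lemma bker_scale a b s t : 0 < s ->
  bker a b s t = cpowR s (a + b - 2) * bker a b 1 (s^-1 * t).
Proof.
move=> s0; rewrite /bker.
set w := s^-1 * t.
have tE : t = s * w by rewrite /w mulrA mulfV ?mul1r ?gt_eqF.
rewrite [in hpow a t]tE (_ : s - t = s * (1 - w)); last by rewrite tE mulrBr mulr1.
rewrite (hpowZ a w s0) (hpowZ b (1 - w) s0).
have -> : a + b - 2 = (a - 1) + (b - 1) by ring.
by rewrite (cpowRD s (a - 1) (b - 1)); ring.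
Qed.

(** Homogeneity reduces every [s > 0] to [s = 1]; for [s <= 0] the kernel is identically 0. *)
Lemma has_cint_bker a b B : has_cint leb (bker a b 1) B ->
  forall s, has_cint leb (bker a b s) (B * hpow (a + b) s).
Proof.
move=> h s; have [s0|s0] := ltP 0 s; last first.
  rewrite hpow_le0// mulr0; apply: (has_cint_ext (g := fun=> 0)).
    move=> t; rewrite /bker; have [t0|t0] := ltP 0 t.
      by rewrite (@hpow_le0 _ b) ?mulr0// subr_le0 (le_trans s0)// ltW.
    by rewrite (@hpow_le0 _ a) ?mul0r.
  exact: has_cint0.
have sV0 : 0 < s^-1 by rewrite invr_gt0.
have := has_cint_affine 0 sV0 h => /(has_cint_scale (cpowR s (a + b - 2))).
rewrite invrK => h'.
have -> : B * hpow (a + b) s = cpowR s (a + b - 2) * (s%:C%C * B).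
  rewrite hpow_gt0// -(cpowR_id s0) (_ : a + b - 1 = (a + b - 2) + 1); last by ring.
  by rewrite cpowRD; ring.
apply: has_cint_ext h' => t.
by rewrite bker_scale// addr0.
Qed.

Lemma bker_rpart_ge0 (a b : R) s t : 0 <= complex.Re (bker a%:C%C b%:C%C s t).
Proof. by rewrite -(rpartR a) -(rpartR b) -normr_bker Re_normr_ge0. Qed.

(** Monotone convergence along [[u n, 1[]: on each such interval the fundamental theorem of calculus
    bounds the integral of the norm by [1 / Re z]. *)
Lemma cintegrable_bker1 z : 0 < complex.Re z -> cintegrable leb setT (bker z 1 1).
Proof.
move=> z0; apply: cintegrable_norm; first exact: cmeas_bker.
pose x := complex.Re z; pose f (t : measurableTypeR R) := (complex.Re (bker x%:C%C 1 1 t))%:E.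
rewrite (eq_integral f); last by move=> t _; rewrite normr_bker.
have mf : measurable_fun setT f.
  by apply/measurable_EFinP; exact: cmeas_Re (cmeas_bker _ _ _).
have f0 t : (0 <= f t)%E by rewrite lee_fin bker_rpart_ge0.
(* Starting from [n + 2] keeps [u n] strictly between 0 and 1. *)
pose u n : R := n.+2%:R^-1.
have u0 n : 0 < u n by rewrite invr_gt0.
have u1 n : u n < 1 by rewrite invf_lt1 ?ltr1n.
pose F n : set (measurableTypeR R) := `[u n, 1[%classic.
have intF n : (\int[leb]_(t in F n) f t <= (x^-1)%:E)%E.
  have u01 : 0 < u n < 1 by rewrite u0 u1.
  have /has_cintE[_ _ h _] := has_cint_scale (x^-1%:C%C) (has_cint_cpowR_itv x%:C%C u01).
  rewrite integral_mkcond; rewrite [leLHS](_ : _ = (complex.Re (x^-1%:C%C *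
      (1 - cpowR (u n) x%:C%C)))%:E).
    rewrite lee_fin cReZ ler_piMr ?invr_ge0 ?(ltW z0)//.
    rewrite cReD cReN [complex.Re 1]/= gerBl.
    rewrite -[x%:C%C]rpartR -normr_cpowR; exact: Re_normr_ge0.
  rewrite -h; apply: eq_integral => t _; rewrite patchE mem_setE in_itv/=.
  rewrite -mulrBr mulrA -rmorphM/= mulVf ?gt_eqF// mul1r /bker -mulrBr /f /bker.
  have [tu|ut] /= := ltP t (u n).
    rewrite [hpow 1 (1 - t)]hpow_gt0 ?subr_gt0 ?(lt_trans tu (u1 n))//.
    by rewrite [hpow 1 (u n - t)]hpow_gt0 ?subr_gt0// subrr !cpowR0 subrr mulr0.
  rewrite [hpow 1 (u n - t)]hpow_le0 ?subr_le0// subr0.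
  case: ifPn => // t1; rewrite [hpow 1 (1 - t)]hpow_le0 ?mulr0//.
  by rewrite subr_le0 leNgt.
have ndF : nondecreasing_seq F.
  apply/nondecreasing_seqP => n; rewrite subsetEset.
  apply: subset_itvr; rewrite bnd_simp /u lef_pV2 ?posrE// ler_nat.
  by rewrite ltnW.
have mF n : measurable (F n) by exact: measurable_itv.
have cv := @ge0_nondecreasing_set_cvg_integral _ _ _ F f leb ndF mF
  (fun i => measurable_funTS mf) (fun _ _ _ => f0 _).
have FE : \bigcup_i F i = `]0, 1[%classic.
  apply/seteqP; split=> [t [n _]|t] /=; rewrite /F/= !in_itv/=.
    by move=> /andP[/(lt_le_trans (u0 n)) -> ->].
  move=> /andP[t0 t1].
  have [n nt] := ltr_add_invr t0; exists n => //=; rewrite in_itv/= t1 andbT.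
  apply: ltW; rewrite add0r in nt; apply: le_lt_trans nt.
  by rewrite /u lef_pV2 ?posrE// ler_nat.
rewrite (_ : \int[leb]_t f t = \int[leb]_(t in \bigcup_i F i) f t)%E; last first.
  rewrite FE [RHS]integral_mkcond; apply: eq_integral => t _.
  rewrite patchE mem_setE in_itv/= /f /bker.
  have [t0|t0] /= := ltP 0 t; last by rewrite hpow_le0 ?mul0r.
  case: ifPn => // t1; rewrite [hpow 1 (1 - t)]hpow_le0 ?mulr0//.
  by rewrite subr_le0 leNgt.
apply: (@le_lt_trans _ _ (x^-1)%:E); last exact: ltry.
rewrite -(cvg_lim _ cv)//; apply: lime_le; first by apply/cvg_ex; eexists; exact: cv.
exact: nearW.
Qed.

(** Once integrability is known, the value [G] needs no limit: scaling gives
    [z G (1 - u^z) = 1 - u^z], and [u^z] differs from 1 because its norm is [u^(Re z) < 1]. Any [u]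
    in []0, 1[] would do. *)
Lemma has_cint_bker1 z : 0 < complex.Re z -> has_cint leb (bker z 1 1) z^-1.
Proof.
move=> z0; have iz := cintegrable_bker1 z0.
have [G hG] : exists G, has_cint leb (bker z 1 1) G by exists (cintegral leb setT (bker z 1 1)).
have zn0 : z != 0 by apply: contraTneq z0 => ->; rewrite ltxx.
pose u : R := 2^-1.
have u01 : 0 < u < 1 by rewrite /u invr_gt0 invf_lt1 ?ltr1n ltr0n.
have /andP[u0 u1] := u01.
have h1 := has_cint_cpowR_itv z u01.
have h2 := has_cintB (has_cint_scale z hG) (has_cint_scale z (has_cint_bker hG u)).
have := has_cint_uniq h1 h2.
rewrite hpow_gt0// addrK -mulrBr => E.
have w1 : 1 - cpowR u z != 0.
  rewrite subr_eq0; apply/negP => /eqP w1.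
  have := congr1 (fun w => complex.Re `|w|) w1.
  rewrite normr_cpowR Re_cpowR_rpart// normr1/= => /eqP.
  rewrite eq_sym powR_eq1 (lt_eqF u1) (gt_eqF z0) orbF/= => u_lt0.
  by move: u0; rewrite ltNge ltW.
have -> : z^-1 = G; last by [].
apply: (mulfI zn0); apply: (mulIf w1); rewrite mulfV// mul1r {1}E.
by ring.
Qed.

Lemma has_cint_bker_1 z s : 0 < complex.Re z ->
  has_cint leb (bker z 1 s) (z^-1 * hpow (z + 1) s).
Proof. by move=> z0; exact: (has_cint_bker (has_cint_bker1 z0)). Qed.

End power_integral.

Section gamma.
Context {R : realType}.
Local Notation leb := (@lebesgue_measure R).
Implicit Types (z a b : R[i]).

Definition gker z (t : measurableTypeR R) : R[i] := hpow z t * (expR (- t))%:C%C.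

Lemma cmeas_gker z : cmeas (gker z).
Proof.
apply: cmeasM; first exact: cmeas_hpow.
apply: cmeas_real; apply: measurableT_comp => //.
Qed.

Lemma normr_gker z t : `|gker z t| = gker (rpart z) t.
Proof. by rewrite /gker normrM normr_hpow normrC_ge0 ?expR_ge0. Qed.

Lemma gker_rpart_ge0 (x : R) t : 0 <= complex.Re (gker x%:C%C t).
Proof. by rewrite -(rpartR x) -normr_gker Re_normr_ge0. Qed.

Lemma Re_gker_rpart (x t : R) : 0 < t ->
  complex.Re (gker x%:C%C t) = expR ((x - 1) * ln t - t).
Proof.
move=> t0; rewrite /gker hpow_gt0// cReM /= mulr0 subr0 /cpowR/=.
by rewrite oppr0 addr0 mul0r cos0 mulr1 -expRD.
Qed.

(** On []0, 1[] the factor [e^(-t)] is at most 1. For [t >= 1], the tangent bound on [ln] at [2 x]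
    gives [x ln t <= t / 2 - x + x ln (2 x)], which leaves [e^(-t / 2)]; the factor 2 cancels the
    normalization of the exponential density. *)
Lemma gker_bound (x t : R) : 0 < x -> complex.Re (gker x%:C%C t) <=
  complex.Re (bker x%:C%C 1 1 t) + (2 * expR (x * ln (2 * x))) * exponential_pdf 2^-1 t.
Proof.
move=> x0.
have C0 : 0 <= 2 * expR (x * ln (2 * x)) * exponential_pdf 2^-1 t.
  by rewrite mulr_ge0 ?exponential_pdf_ge0 ?mulr_ge0 ?expR_ge0 ?invr_ge0.
have [t0|t0] := ltP 0 t; last first.
  by rewrite /gker hpow_le0// mul0r addr_ge0// bker_rpart_ge0.
have [t1|t1] := ltP t 1.
  rewrite -[leLHS]addr0 lerD// /bker [hpow 1 _]hpow_gt0 ?subr_gt0// subrr cpowR0 mulr1.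
  rewrite /gker mulrC cReZ ler_piMl//.
    by rewrite -(rpartR x) -normr_hpow Re_normr_ge0.
  by rewrite -[leRHS]expR0 ler_expR oppr_le0 ltW.
rewrite -[leLHS]add0r lerD ?bker_rpart_ge0// Re_gker_rpart//.
have -> : exponential_pdf 2^-1 t = 2^-1 * expR (- 2^-1 * t).
  by rewrite exponential_pdfE// ltW.
rewrite (_ : _ * (2^-1 * _) = expR (x * ln (2 * x)) * expR (- 2^-1 * t)); last by field.
rewrite -expRD ler_expR.
have x20 : 0 < 2 * x by rewrite mulr_gt0.
have lnle : ln t <= t / (2 * x) - 1 + ln (2 * x).
  rewrite -lerBlDr -ln_div ?posrE//.
  have := @le_ln1Dx R (t / (2 * x) - 1).
  rewrite (_ : 1 + (t / (2 * x) - 1) = t / (2 * x)); last by ring.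
  apply.
  by rewrite -subr_gt0 opprK subrK divr_gt0.
have ln0 : 0 <= ln t by exact: ln_ge0.
have : x * ln t <= x * (t / (2 * x) - 1 + ln (2 * x)) by rewrite ler_pM2l.
have -> : x * (t / (2 * x) - 1 + ln (2 * x)) = t / 2 - x + x * ln (2 * x).
  by field; rewrite gt_eqF.
lra.
Qed.

Lemma cintegrable_gker z : 0 < complex.Re z -> cintegrable leb setT (gker z).
Proof.
move=> z0; apply: cintegrable_norm; first exact: cmeas_gker.
set x := complex.Re z in z0.
pose C := 2 * expR (x * ln (2 * x)).
rewrite (eq_integral (fun t => (complex.Re (gker x%:C%C t))%:E)); last first.
  by move=> t _; rewrite normr_gker.
have [i1 _] := @cintegrable_bker1 R x%:C%C z0.
have half0 : (0 : R) < 2^-1 by rewrite invr_gt0.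
have i2 := integrable_exponential_pdf half0.
have i3 : leb.-integrable setT (fun t => (C * exponential_pdf 2^-1 t)%:E).
  by under eq_fun do rewrite EFinM; exact: integrableZl.
have i4 : leb.-integrable setT (fun t => (complex.Re (bker x%:C%C 1 1 t) +
    C * exponential_pdf 2^-1 t)%:E).
  by under eq_fun do rewrite EFinD; exact: integrableD.
have i5 : leb.-integrable setT (fun t => (complex.Re (gker x%:C%C t))%:E).
  apply: (le_integrable measurableT _ _ i4).
    by apply/measurable_EFinP; exact: cmeas_Re (cmeas_gker _).
  move=> t _ /=; rewrite lee_fin (ger0_norm (gker_rpart_ge0 _ _)).
  by apply: le_trans (ler_norm _); exact: gker_bound.
by rewrite ltey_eq (integrable_fin_num measurableT i5).
Qed.

Lemma has_cint_gker z : 0 < complex.Re z -> has_cint leb (gker z) (cGamma z).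
Proof.
move=> z0; split; first exact: cintegrable_gker.
rewrite /cGamma /cintegral.
have E t : gker z t =
    if t \in `]0, +oo[ then cpowR t (z - 1) * (expR (- t))%:C%C else 0.
  rewrite in_itv/= andbT /gker; have [t0|t0] := ltP 0 t.
    by rewrite hpow_gt0.
  by rewrite hpow_le0// mul0r.
congr Complex; rewrite [RHS]Rintegral_mkcond; apply: eq_Rintegral => t _;
  by rewrite patchE mem_setE E; case: ifP.
Qed.

Lemma cGamma1 : cGamma 1 = 1 :> R[i].
Proof.
have /has_cintE[_ _ h1 h2] := @has_cint_gker 1 ltr01.
apply: complex_ext; apply: EFin_inj.
- rewrite -h1 -(integral_exponential_pdf (@ltr01 R)).
  have E : (\int[leb]_x (exponential_pdf 1 x)%:E =
      \int[leb]_(x in `[0%R, +oo[) (expR (- x))%:E)%E.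
    rewrite [RHS]integral_mkcond; apply: eq_integral => t _.
    rewrite patchE mem_setE in_itv/= andbT; case: ifPn => t0.
      by rewrite exponential_pdfE//= mul1r mulN1r.
    by rewrite lt0_exponential_pdf// ltNge.
  rewrite E -integral_itv_obnd_cbnd; last first.
    by apply/measurable_EFinP; apply: measurable_funTS; apply: measurableT_comp.
  rewrite [RHS]integral_mkcond; apply: eq_integral => t _.
  rewrite patchE mem_setE in_itv/= andbT /gker; have [t0|t0] := ltP 0 t.
    by rewrite hpow_gt0// subrr cpowR0 mul1r.
  by rewrite hpow_le0// mul0r.
- rewrite -h2 integral0_eq// => t _; rewrite /gker.
  have [t0|t0] := ltP 0 t; last by rewrite hpow_le0// mul0r.
  by rewrite hpow_gt0// subrr cpowR0 mul1r.
Qed.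

(** Both orders of integration of [x^(a-1) (s - x)^(b-1) e^(-s)] over [0 < x < s]: one gives
    [Gamma(a) Gamma(b)] by translation, the other [B Gamma(a + b)] by homogeneity. The relation is
    left as a product, since [Gamma(a + b)] is not yet known to be nonzero. *)
Lemma beta_gamma a b : 0 < complex.Re a -> 0 < complex.Re b ->
  exists2 B, has_cint leb (bker a b 1) B & B * cGamma (a + b) = cGamma a * cGamma b.
Proof.
move=> a0 b0.
pose P a b (p : measurableTypeR R * measurableTypeR R) : R[i] :=
  bker a b p.2 p.1 * (expR (- p.2))%:C%C.
have mP a' b' : cmeas (P a' b').
  apply: cmeasM; last first.
    apply: cmeas_real; apply: measurableT_comp => //; apply: measurableT_comp => //.
  apply: cmeasM; first exact: (cmeas_comp (cmeas_hpow _)).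
  by apply: (cmeas_comp (cmeas_hpow b')); exact: measurable_funB.
have PE a' b' x s : P a' b' (x, s) = gker a' x * gker b' (s - x).
  rewrite /P /bker /gker/= -!mulrA; congr (_ * _); rewrite mulrCA; congr (_ * _).
  by rewrite -rmorphM/= -expRD; congr ((expR _)%:C%C); ring.
have inner a' b' : 0 < complex.Re b' -> forall x,
    has_cint leb (fun s => P a' b' (x, s)) (gker a' x * cGamma b').
  move=> b'0 x; apply: (has_cint_ext (PE a' b' x)).
  apply: has_cint_scale.
  exact: (has_cint_translate x (has_cint_gker b'0)).
have outer a' b' : 0 < complex.Re a' ->
    has_cint leb (fun x => gker a' x * cGamma b') (cGamma a' * cGamma b').
  by move=> a'0; apply: has_cint_scaler; exact: has_cint_gker.
have hP : has_cint (leb \x leb)%E (P a b) (cGamma a * cGamma b).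
  apply: (has_cint_fubini (mP a b) (inner a b b0) _ (outer a b a0) (outer (rpart a) (rpart b) a0)).
  move=> x; apply: (has_cint_ext (g := fun s => P (rpart a) (rpart b) (x, s))).
    by move=> s; rewrite /P normrM normr_bker normrC_ge0// expR_ge0.
  exact: inner.
(* Integrability of the beta kernel comes from Fubini instead of an estimate: almost every fibre is
   integrable, []0, 1[] is not negligible, and by homogeneity a single [s > 0] is enough. *)
have [s [s0 is1 is2]] : exists s, [/\ 0 < s,
   leb.-integrable setT (fun x => (complex.Re (P a b (x, s)))%:E) &
   leb.-integrable setT (fun x => (complex.Im (P a b (x, s)))%:E)].
  have [[i1 i2] _] := hP.
  have ae1 := ae_integrable2 i1; have ae2 := ae_integrable2 i2.
  have [N [mN N0 NS]] : leb.-negligible (~` [set s |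
      leb.-integrable setT (fun x => (complex.Re (P a b (x, s)))%:E) /\
      leb.-integrable setT (fun x => (complex.Im (P a b (x, s)))%:E)]).
    have : {ae leb, forall s, leb.-integrable setT (fun x => (complex.Re (P a b (x, s)))%:E) /\
      leb.-integrable setT (fun x => (complex.Im (P a b (x, s)))%:E)}.
      by apply: filterS2 ae1 ae2 => s ? ?; split.
    by [].
  apply: contrapT => /forallNP hN.
  have : (leb `]0%R, 1%R[%classic <= leb N)%E.
    apply: le_measure; rewrite ?inE//.
    move=> s /=; rewrite in_itv/= => /andP[s0 _]; apply: NS => -[? ?].
    by apply: (hN s); split.
  by rewrite N0 lebesgue_measure_itv/= lte_fin ltr01 oppr0 adde0 lee_fin ler10.
have : cintegrable leb setT (bker a b s).
  have hPs : has_cint leb (fun x => P a b (x, s)) (cintegral leb setT (fun x => P a b (x, s))).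
    by split.
  have := has_cint_scale (expR s)%:C%C hPs => -[].
  rewrite (_ : (fun x => _) = bker a b s)//; apply/funext => x.
  by rewrite /P/= mulrCA -rmorphM/= expRN mulfV ?expR_eq0// mulr1.
move=> ibs.
have hB := has_cint_affine 0 s0 (conj ibs erefl).
have {hB} [B hB] : exists B, has_cint leb (bker a b 1) B.
  eexists; apply: has_cint_ext (has_cint_scale (cpowR s (a + b - 2))^-1 hB) => x.
  rewrite addr0 (@bker_scale _ a b s (s * x) s0) mulKf ?cpowR_neq0//.
  by rewrite mulrA mulVf ?mul1r ?gt_eqF.
exists B => //.
have h1 : has_cint leb (fun s => B * gker (a + b) s) (cGamma a * cGamma b).
  apply: (has_cint_fubini2 hP) => s'.
  rewrite /P/= /gker mulrA; apply: has_cint_scaler; exact: has_cint_bker.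
have h2 : has_cint leb (fun s => B * gker (a + b) s) (B * cGamma (a + b)).
  apply: has_cint_scale; apply: has_cint_gker.
  by rewrite cReD addr_gt0.
exact: has_cint_uniq h2 h1.
Qed.

(** No integration by parts: the beta integral at [(z, 1)] is [1 / z], and [Gamma(1) = 1]. *)
Lemma cGammaS z : 0 < complex.Re z -> cGamma (z + 1) = z * cGamma z.
Proof.
move=> z0; have [B hB] := @beta_gamma z 1 z0 (@ltr01 R).
rewrite (has_cint_uniq hB (has_cint_bker1 z0)) cGamma1 mulr1 => <-.
have zn0 : z != 0 by apply: contraTneq z0 => ->; rewrite ltxx.
by rewrite mulrA mulfV// mul1r.
Qed.

End gamma.

(** * Non-vanishing of the gamma function *)

Section gamma_neq0.
Context {R : realType}.
Local Notation leb := (@lebesgue_measure R).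
Implicit Types (z : R[i]) (s t x y : R).

Lemma has_cint_le d (T : measurableType d) (mu : {measure set T -> \bar R})
    (f g : T -> R[i]) v w : has_cint mu f v -> has_cint mu g w ->
  (forall i, complex.Re (f i) <= complex.Re (g i)) -> complex.Re v <= complex.Re w.
Proof.
move=> /has_cintE[f1 _ f2 _] /has_cintE[g1 _ g2 _] fg.
by rewrite -lee_fin -f2 -g2; apply: le_integral => // x _; rewrite lee_fin.
Qed.

Lemma normr_sin_le x : `|sin x| <= `|x|.
Proof.
wlog x0 : x / 0 <= x => [H|].
  have [/H//|/ltW x0] := leP 0 x.
  by rewrite -(normrN (sin x)) -sinN -(normrN x) H// oppr_ge0.
have [|c _] := @MVT_segment R sin cos 0 x x0 (fun t _ => is_derive_sin t).
  by apply: continuous_subspaceT => t; exact: continuous_sin.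
rewrite sin0 !subr0 => ->; rewrite normrM ler_piMl//.
exact: cos_max.
Qed.

Lemma cos_ge_quadratic x : 1 - x ^+ 2 / 2 <= cos x.
Proof.
have -> : cos x = 1 - 2 * sin (x / 2) ^+ 2.
  by rewrite {1}(_ : x = (x / 2) *+ 2) ?cos_mulr2n ?cos2sin2; [ring|field].
have : sin (x / 2) ^+ 2 <= (x / 2) ^+ 2.
  by rewrite -[leLHS]real_normK ?num_real// -[leRHS]real_normK ?num_real//
    lerXn2r ?nnegrE ?normr_ge0 ?normr_sin_le.
have -> : (x / 2) ^+ 2 = x ^+ 2 / 4 by field.
lra.
Qed.

Lemma ln_geBV x : 0 < x -> 1 - x^-1 <= ln x.
Proof.
move=> x0; have := @le_ln1Dx R (x^-1 - 1).
rewrite (_ : 1 + (x^-1 - 1) = x^-1); last by ring.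
rewrite lnV ?posrE// => h; suff : - ln x <= x^-1 - 1 by lra.
by apply: h; rewrite -subr_gt0 opprK subrK invr_gt0.
Qed.

Lemma ln_leB1 x : 0 < x -> ln x <= x - 1.
Proof.
move=> x0; have := @le_ln1Dx R (x - 1).
rewrite (_ : 1 + (x - 1) = x); last by ring.
by apply; rewrite -subr_gt0 opprK subrK.
Qed.

(** The first square controls the logarithm above 1, the second below 1. Only integer powers of [x]
    occur, so at [x = t / s] the integrals against [t^(s-1) e^(-t)] are gamma values at integer
    shifts of [s]. *)
Lemma sqr_ln_le x : 0 < x -> ln x ^+ 2 <= (x - 1) ^+ 2 + (x^-1 - 1) ^+ 2.
Proof.
move=> x0; have h1 := ln_leB1 x0; have h2 := ln_geBV x0.
have [l0|l0] := leP 0 (ln x).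
  have : ln x ^+ 2 <= (x - 1) ^+ 2 by rewrite lerXn2r ?nnegrE// (le_trans l0).
  by have := sqr_ge0 (x^-1 - 1); lra.
have : (- ln x) ^+ 2 <= (x^-1 - 1) ^+ 2.
  by rewrite lerXn2r ?nnegrE ?oppr_ge0 ?(ltW l0)//; lra.
by rewrite sqrrN; have := sqr_ge0 (x - 1); lra.
Qed.

Lemma gker_add1 z t : gker (z + 1) t = t%:C%C * gker z t.
Proof.
rewrite /gker; have [t0|t0] := ltP 0 t; last by rewrite !hpow_le0// !mul0r mulr0.
rewrite -hpowM cpowR_id//; ring.
Qed.

(** For [t > 0], [t^(x-1)] lies above its tangent at [t = 1], which is [(x - 1) t - (x - 2)].
    Against [e^(-t)] the tangent integrates to 1, because [Gamma(1) = Gamma(2) = 1]. *)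
Lemma Re_cGamma_ge1 x : 2 <= x -> 1 <= complex.Re (cGamma x%:C%C).
Proof.
move=> x2; have x0 : 0 < x by lra.
have h1 : has_cint leb (gker x%:C%C) (cGamma x%:C%C) by exact: has_cint_gker.
have h2 : has_cint leb (gker 1%:C%C) 1 by have := @has_cint_gker R 1 ltr01; rewrite cGamma1.
have h3 : has_cint leb (gker (1%:C%C + 1)) 1.
  have := @has_cint_gker R (1 + 1); rewrite cGammaS ?cGamma1 ?mul1r; last exact: ltr01.
  by apply; rewrite cReD addr_gt0// ltr01.
have h4 := has_cintB (has_cint_scale (x - 1)%:C%C h3) (has_cint_scale (x - 2)%:C%C h2).
have := has_cint_le h4 h1; rewrite !mulr1 -rmorphB/=.
rewrite (_ : x - 1 - (x - 2) = 1); last by ring.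
apply=> t; rewrite gker_add1 cReD cReN !cReZ.
have [t0|t0] := ltP 0 t; last by rewrite /gker !hpow_le0// !mul0r/= !mulr0 subrr.
rewrite !Re_gker_rpart// subrr mul0r sub0r.
have -> : expR ((x - 1) * ln t - t) = expR (- t) * expR ((x - 2) * ln t) * t.
  by rewrite -[in X in _ = _ * X](lnK t0) -!expRD; congr expR; ring.
have e0 := expR_gt0 (- t).
set e := expR (- t) in e0 *.
have h : t * (1 + (x - 2) * (1 - t^-1)) <= t * expR ((x - 2) * ln t).
  rewrite ler_pM2l//; apply: le_trans (expR_ge1Dx _); rewrite lerD2l.
  by rewrite ler_wpM2l ?subr_ge0// ln_geBV.
have : e * (t * (1 + (x - 2) * (1 - t^-1))) <= e * (t * expR ((x - 2) * ln t)).
  by rewrite ler_pM2l.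
have -> : t * (1 + (x - 2) * (1 - t^-1)) = (x - 1) * t - (x - 2).
  by field; rewrite gt_eqF.
lra.
Qed.

(* The lower bound that [cos theta >= 1 - theta^2 / 2], at
   [theta = y ln (t / s)], and [sqr_ln_le] give for the integrand of
   [cGamma (s + i y)], rotated to be nearly real around [t = s];
   here [c = y^2 / 2]. *)
Let low_ker s c t : R[i] :=
  (1 - 2 * c)%:C%C * gker s%:C%C t + ((- c / s ^+ 2)%:C%C * gker (s + 2)%:C%C t +
  ((2 * c / s)%:C%C * gker (s + 1)%:C%C t + ((2 * c * s)%:C%C * gker (s - 1)%:C%C t +
  (- c * s ^+ 2)%:C%C * gker (s - 2)%:C%C t))).

Lemma low_ker_le s y t : 0 < s -> complex.Re (low_ker s (y ^+ 2 / 2) t) <=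
  complex.Re (cpowR s (Complex 0 (- y)) * gker (Complex s y) t).
Proof.
move=> s0; set c := y ^+ 2 / 2.
rewrite /low_ker !(cReD, cReZ).
have [t0|t0] := ltP 0 t; last first.
  by rewrite /gker !hpow_le0// !mul0r mulr0/= !mulr0 !addr0.
rewrite !Re_gker_rpart//.
(* The kernel of smallest exponent among the five is factored out, so that the others are [P] times
   a power of [t]. *)
pose P := expR ((s - 3) * ln t - t).
have P0 : 0 < P by exact: expR_gt0.
have PE k n : k = s - 2 + n%:R -> expR ((k - 1) * ln t - t) = t ^+ n * P.
  move=> ->; rewrite -[in t ^+ n](lnK t0) -expRM_natl /P -expRD.
  by congr expR; ring.
rewrite (PE s 2%N) ?(PE (s + 2) 4%N) ?(PE (s + 1) 3%N) ?(PE (s - 1) 1%N)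
  ?(PE (s - 2) 0%N); do ?ring.
(* Rotation by [s^(-i y)] turns the phase [y ln t] into [y ln (t / s)], which vanishes at
   [t = s]. *)
have -> : complex.Re (cpowR s (Complex 0 (- y)) * gker (Complex s y) t) =
    cos (y * ln (t / s)) * (t ^+ 2 * P).
  rewrite -(PE s 2%N); last by ring.
  rewrite /gker hpow_gt0// /cpowR/= mul0r expR0 !mul1r subr0.
  rewrite ln_div ?posrE// (mulrBr y) cosB expRD mulNr cosN sinN.
  by ring.
have u0 : 0 < t / s by rewrite divr_gt0.
have tn : t != 0 by rewrite gt_eqF.
have sn : s != 0 by rewrite gt_eqF.
(* Expanding both squares in [t / s] gives exactly the coefficients of [low_ker]. *)
apply: (@le_trans _ _ ((1 - c * ((t / s - 1) ^+ 2 + ((t / s)^-1 - 1) ^+ 2)) * (t ^+ 2 * P))).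
  by rewrite le_eqVlt; apply/orP; left; apply/eqP; field; rewrite tn sn.
rewrite ler_pM2r ?mulr_gt0 ?exprn_gt0//.
apply: le_trans (cos_ge_quadratic _); rewrite lerD2l lerN2 exprMn.
have -> : y ^+ 2 * ln (t / s) ^+ 2 / 2 = c * ln (t / s) ^+ 2 by rewrite /c; ring.
by rewrite ler_wpM2l ?sqr_ln_le// divr_ge0 ?sqr_ge0.
Qed.

(** The integral of [low_ker] divided by [Gamma(s - 2)]. The terms in [c s^2] cancel, which leaves a
    loss of order [c s] against [s^2]; this is why [c] may grow like a small multiple of [s]. *)
Let low_val s c : R := (s - 1) * (s - 2) - c * ((s - 1) * (s - 2) / s + s + 2).

Lemma has_cint_low_ker s c : 2 < s -> exists2 w, has_cint leb (low_ker s c) w &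
  complex.Re w = low_val s c * complex.Re (cGamma (s - 2)%:C%C).
Proof.
move=> s2; set G := cGamma _.
have hg (k : R) : 0 < k -> has_cint leb (gker k%:C%C) (cGamma k%:C%C).
  by move=> k0; exact: has_cint_gker.
have FE (k : R) : 0 < k -> cGamma ((k + 1)%:C%C) = k%:C%C * cGamma k%:C%C :> R[i].
  by move=> k0; rewrite rmorphD/= cGammaS.
have s0 : 0 < s by lra.
have sb2 : 0 < s - 2 by lra.
have sb1 : 0 < s - 1 by lra.
have s1 : 0 < s + 1 by lra.
have s3 : 0 < s + 2 by lra.
have e1 : s - 1 = s - 2 + 1 by ring.
have e2 : s = s - 1 + 1 by ring.
have e4 : s + 2 = s + 1 + 1 by ring.
have E1 : cGamma (s - 1)%:C%C = (s - 2)%:C%C * G by rewrite e1 (FE _ sb2).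
have E2 : cGamma s%:C%C = ((s - 1) * (s - 2))%:C%C * G.
  by rewrite [in LHS]e2 (FE _ sb1) E1 mulrA -rmorphM.
have E3 : cGamma (s + 1)%:C%C = (s * ((s - 1) * (s - 2)))%:C%C * G.
  by rewrite (FE _ s0) E2 mulrA -rmorphM.
have E4 : cGamma (s + 2)%:C%C = ((s + 1) * (s * ((s - 1) * (s - 2))))%:C%C * G.
  by rewrite e4 (FE _ s1) E3 mulrA -rmorphM.
eexists.
  exact: (has_cintD (has_cint_scale (1 - 2 * c)%:C%C (hg _ s0))
    (has_cintD (has_cint_scale (- c / s ^+ 2)%:C%C (hg _ s3))
    (has_cintD (has_cint_scale (2 * c / s)%:C%C (hg _ s1))
    (has_cintD (has_cint_scale (2 * c * s)%:C%C (hg _ sb1))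
     (has_cint_scale (- c * s ^+ 2)%:C%C (hg _ sb2)))))).
rewrite E1 E2 E3 E4 -/G !(cReD, cReZ) /low_val.
move: (complex.Re G) => g.
by field; rewrite gt_eqF.
Qed.

Lemma low_val_gt0 s c : 4 <= s -> 0 <= c <= s / 8 -> 0 < low_val s c.
Proof.
move=> s4 /andP[c0 cs]; rewrite /low_val.
have qs : (s - 1) * (s - 2) / s <= s by rewrite ler_pdivrMr; nra.
have : c * ((s - 1) * (s - 2) / s + s + 2) <= s / 8 * (2 * s + 2).
  apply: ler_pM => //; last by lra.
  by rewrite !addr_ge0 ?divr_ge0 ?mulr_ge0//; lra.
nra.
Qed.

Lemma cGamma_neq0_large s y : 4 <= s -> y ^+ 2 <= s / 4 ->
  cGamma (Complex s y) != 0.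
Proof.
move=> s4 ys; apply/negP => /eqP G0.
have s0 : 0 < s by lra.
have h0 := has_cint_scale (cpowR s (Complex 0 (- y))) (@has_cint_gker R (Complex s y) s0).
have s2 : 2 < s by lra.
have [w hw Ew] := has_cint_low_ker (y ^+ 2 / 2) s2.
have := has_cint_le hw h0 (fun t => low_ker_le y t s0).
rewrite Ew G0 mulr0 leNgt => /negP; apply.
rewrite mulr_gt0 ?low_val_gt0//.
  by rewrite divr_ge0 ?sqr_ge0//=; lra.
by apply: lt_le_trans (Re_cGamma_ge1 _) => //; lra.
Qed.

Lemma cGamma_neq0 z : 0 < complex.Re z -> cGamma z != 0.
Proof.
case: z => x y /= x0.
(* By the functional equation a zero at [z] propagates to [z + 1], so non-vanishing far to the right
   descends. *)
have shift n : cGamma (Complex (x + n%:R) y) != 0 -> cGamma (Complex x y) != 0.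
  elim: n => [|n IH]; first by rewrite addr0.
  move=> h; apply: IH; apply: contraNneq h => h.
  have -> : Complex (x + n.+1%:R) y = Complex (x + n%:R) y + 1.
    by apply: complex_ext; rewrite ?cReD ?cImD /= ?addr0// -natr1 addrA.
  by rewrite cGammaS ?h ?mulr0//= ltr_wpDr ?ler0n.
(* With [s = x + n] this ensures both [4 <= s] and [y^2 <= s / 4]. *)
have [n hn] : exists n : nat, 4 + 4 * y ^+ 2 <= n%:R.
  by exists (Num.truncn (4 + 4 * y ^+ 2)).+1; apply/ltW; exact: truncnS_gt.
have n0 := sqr_ge0 y.
apply: (shift n); apply: cGamma_neq0_large; lra.
Qed.

End gamma_neq0.

(** * Radial integrals in the plane *)

Section prod.
Context {R : realType} d1 d2 (T1 : measurableType d1) (T2 : measurableType d2).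
Variables (m1 : {sigma_finite_measure set T1 -> \bar R})
  (m2 : {sigma_finite_measure set T2 -> \bar R}).

Let sf := lebesgue_integral_fubini.measure_function_Measure_isSigmaFinite__to__measure_function_isSigmaFinite m1 m2.

(** A name of its own under which the product measure is sigma-finite, so that products can be
    iterated. *)
Definition sfprod : set (T1 * T2) -> \bar R := (m1 \x m2)%E.
HB.instance Definition _ := Measure.on sfprod.

Let sfprod_sigma_finite : sigma_finite setT sfprod.
Proof.
have [F FT Foo] : sigma_finite setT (m1 \x m2)%E.
  by case: sf.
by exists F.
Qed.
HB.instance Definition _ := @Measure_isSigmaFinite.Build _ _ _ sfprod
  sfprod_sigma_finite.

End prod.

(** * Integration against a restricted measure *)

Section restriction.
Context {R : realType} d (T : measurableType d).
Variables (mu : {measure set T -> \bar R}) (D : set T) (mD : measurable D).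
Local Notation nu := (mrestr mu mD).

Let nuCD : nu (~` D) = 0%E.
Proof. by rewrite /mrestr setICl measure0. Qed.

Let integral_nuD (g : T -> \bar R) : (\int[nu]_(x in D) g x = \int[mu]_(x in D) g x)%E.
Proof.
by apply: eq_measure_integral => A mA AD; rewrite /= /mrestr/= setIidl.
Qed.

Lemma integrable_mrestr (g : T -> R) : measurable_fun setT g ->
  mu.-integrable D (fun x => (g x)%:E) -> nu.-integrable setT (fun x => (g x)%:E).
Proof.
move=> mg ig; have me : measurable_fun setT (fun x => (g x)%:E) by exact/measurable_EFinP.
apply/(negligible_integrable (measurableC mD)) => //.
rewrite setTD setCK; move/integrableP : ig => [m1 foo].
by apply/integrableP; split => //; rewrite integral_nuD.
Qed.

Lemma integral_mrestr (g : T -> R) : measurable_fun setT g ->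
  mu.-integrable D (fun x => (g x)%:E) ->
  (\int[nu]_x (g x)%:E = \int[mu]_(x in D) (g x)%:E)%E.
Proof.
move=> mg ig; have ing := integrable_mrestr mg ig.
by rewrite (negligible_integral (measurableC mD) _ ing)// setTD setCK integral_nuD.
Qed.

Lemma has_cint_mrestr (f : T -> R[i]) v : cmeas f ->
  has_cint mu (fun x => if x \in D then f x else 0) v -> has_cint nu f v.
Proof.
move=> [m1 m2] /has_cintE[i1 i2 e1 e2].
have j1 : mu.-integrable D (fun x => (complex.Re (f x))%:E).
  apply/integrable_mkcond => //; apply: eq_integrable i1 => // x _.
  by rewrite patchE; case: ifP.
have j2 : mu.-integrable D (fun x => (complex.Im (f x))%:E).
  apply/integrable_mkcond => //; apply: eq_integrable i2 => // x _.
  by rewrite patchE; case: ifP.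
apply/has_cintE; split.
- exact: integrable_mrestr.
- exact: integrable_mrestr.
- rewrite integral_mrestr// integral_mkcond -e1; apply: eq_integral => x _.
  by rewrite patchE; case: ifP.
- rewrite integral_mrestr// integral_mkcond -e2; apply: eq_integral => x _.
  by rewrite patchE; case: ifP.
Qed.

End restriction.

Section plane.
Context {R : realType}.
Local Notation leb := (@lebesgue_measure R).
Local Notation RR := (measurableTypeR R).
Implicit Types c : R.

Definition leb2 := sfprod leb leb.

Lemma leb2_rect (A B : set RR) : measurable A -> measurable B ->
  leb2 (A `*` B) = (leb A * leb B)%E.
Proof. exact: product_measure1E. Qed.

Definition aff2 c (b : R * R) (w : RR * RR) : RR * RR := (c * w.1 + b.1, c * w.2 + b.2).

Lemma measurable_aff2 c b : measurable_fun setT (aff2 c b).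
Proof.
apply: measurable_fun_pair; apply: measurable_funD => //;
  by apply: measurable_funM => //; apply: measurableT_comp.
Qed.

Lemma leb2_aff c b (A : set (RR * RR)) : 0 < c -> measurable A ->
  leb2 (aff2 c b @^-1` A) = ((c ^- 2)%:E * leb2 A)%E.
Proof.
move=> c0 mA.
pose pm : {measure set (RR * RR) -> \bar R} :=
  measure_function_pushforward__canonical__measure_function_Measure leb2 (measurable_aff2 c b).
have c20 : 0 <= c ^+ 2 by rewrite sqr_ge0.
have -> : leb2 A = mscale (NngNum c20) pm A.
  apply: product_measure_unique => // B C mB mC.
  have E : aff2 c b @^-1` (B `*` C) = ((fun t : RR => c * t + b.1) @^-1` B) `*`
    ((fun t : RR => c * t + b.2) @^-1` C) by [].
  rewrite -[LHS]/((c ^+ 2)%:E * leb2 (aff2 c b @^-1` (B `*` C)))%E E.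
  have mf e : measurable_fun setT (fun t : RR => c * t + e : RR).
    by apply: measurable_funD => //; exact: measurable_funM.
  rewrite leb2_rect; last 2 first.
  - by rewrite -[X in measurable X]setTI; exact: mf.
  - by rewrite -[X in measurable X]setTI; exact: mf.
  rewrite !lebesgue_affine// muleACA [LHS]muleA.
  rewrite -[X in (X * _)%E]/((c ^+ 2 * (c^-1 * c^-1))%:E).
  by rewrite -invfM -expr2 mulfV ?mul1e// expf_neq0// gt_eqF.
by rewrite /mscale/= muleA -EFinM mulVf ?mul1e// expf_neq0// gt_eqF.
Qed.

Definition nsq (w : RR * RR) : RR := w.1 ^+ 2 + w.2 ^+ 2.

Lemma measurable_nsq : measurable_fun setT nsq.
Proof.
by apply: measurable_funD => //; apply: measurable_funX.
Qed.

Let disc (t : R) : set (RR * RR) := [set w | nsq w <= t].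

Let mdisc t : measurable (disc t).
Proof.
rewrite (_ : disc t = nsq @^-1` `]-oo, t]%classic).
  by rewrite -[X in measurable X]setTI; exact: measurable_nsq.
by apply/seteqP; split => w; rewrite /disc/= in_itv.
Qed.

Let disc_scale t : 0 < t -> leb2 (disc t) = (t%:E * leb2 (disc 1))%E.
Proof.
move=> t0; pose c := (Num.sqrt t)^-1.
have c0 : 0 < c by rewrite invr_gt0 sqrtr_gt0.
have -> : disc t = aff2 c (0, 0) @^-1` disc 1.
  apply/seteqP; split=> w; rewrite /disc/= /nsq/= !addr0 !exprMn -mulrDr exprVn
    sqr_sqrtr ?(ltW t0)//; by rewrite mulrC ler_pdivrMr// mul1r.
by rewrite leb2_aff// /c exprVn sqr_sqrtr ?(ltW t0)// invrK.
Qed.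

Let disc0 t : t <= 0 -> leb2 (disc t) = 0%E.
Proof.
move=> t0; apply: (@subset_measure0 _ _ _ leb2 _ ([set 0] `*` [set 0])) => //.
- exact: measurableX.
- move=> [x y]; rewrite /disc /nsq/= => /le_trans/(_ t0) xy.
  have x2 := sqr_ge0 x; have y2 := sqr_ge0 y.
  have /eqP : x ^+ 2 = 0 by apply/eqP; rewrite eq_le x2 andbT; lra.
  rewrite sqrf_eq0 => /eqP ->.
  have /eqP : y ^+ 2 = 0 by apply/eqP; rewrite eq_le y2 andbT; lra.
  by rewrite sqrf_eq0 => /eqP ->.
- transitivity (leb [set 0%R] * leb [set 0%R])%E; first exact: leb2_rect.
  by rewrite lebesgue_measure_set1 mule0.
Qed.

(** Only finiteness and positivity are extracted here, from a square around the disc and a square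
    inside it; the value is found afterwards from the Gaussian integral. *)
Let area : exists2 A : R, 0 < A & leb2 (disc 1) = A%:E.
Proof.
have sub1 : disc 1 `<=` `[-1, 1]%classic `*` `[-1, 1]%classic.
  move=> [x y]; rewrite /disc /nsq/= !in_itv/= -!ler_norml => xy.
  have x2 := sqr_ge0 x; have y2 := sqr_ge0 y.
  by split; rewrite -(@ler_pXn2r _ 2) ?nnegrE// real_normK ?num_real// expr1n; lra.
have sub2 : `[0, 2^-1]%classic `*` `[0, 2^-1]%classic `<=` disc 1.
  move=> [x y]; rewrite /disc /nsq/= !in_itv/= => -[/andP[x0 x1] /andP[y0 y1]].
  have : x ^+ 2 <= 2^-1 ^+ 2 by rewrite lerXn2r ?nnegrE.
  have : y ^+ 2 <= 2^-1 ^+ 2 by rewrite lerXn2r ?nnegrE.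
  have -> : (2^-1 : R) ^+ 2 = 4^-1 by field.
  lra.
have le1 : (leb2 (disc 1) <= 4%:E)%E.
  have -> : 4%:E = leb2 (`[-1, 1]%classic `*` `[-1, 1]%classic).
    rewrite leb2_rect// lebesgue_measure_itv/= lte_fin.
    rewrite ifT; last by lra.
    by rewrite -EFinB -EFinM; congr EFin; ring.
  by apply: le_measure; rewrite ?inE//; exact: measurableX.
have ge1 : ((4^-1)%:E <= leb2 (disc 1))%E.
  have -> : (4^-1)%:E = leb2 (`[0, 2^-1]%classic `*` `[0, 2^-1]%classic).
    rewrite leb2_rect// lebesgue_measure_itv/= lte_fin.
    rewrite ifT; last by lra.
    by rewrite -EFinB -EFinM; congr EFin; field.
  by apply: le_measure; rewrite ?inE//; exact: measurableX.
move: le1 ge1; case: (leb2 (disc 1)) => //= A _; rewrite lee_fin => A4.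
by exists A => //; lra.
Qed.

(** By scaling, the disc of squared radius [t] has area [t A]. The squared norm thus pushes planar
    measure to [A] times Lebesgue measure on the half-line, as a comparison on the intervals []a,
    b]] shows. *)
Let nsq_image (A : R) : leb2 (disc 1) = A%:E -> 0 < A ->
  forall B, measurable B ->
  leb2 (nsq @^-1` B) = (A%:E * mrestr leb (measurable_itv `]0%R, +oo[) B)%E.
Proof.
move=> hA A0 B mB.
have discE t : leb2 (disc t) = (Num.max t 0 * A)%:E.
  have [t0|t0] := leP t 0; first by rewrite mul0r disc0.
  by rewrite disc_scale// hA.
pose pm : {measure set RR -> \bar R} :=
  measure_function_pushforward__canonical__measure_function_Measure leb2 measurable_nsq.
pose nu : {measure set RR -> \bar R} := mscale (NngNum (ltW A0)) (mrestr leb (measurable_itv `]0%R, +oo[)).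
rewrite -[LHS]/(pm B) -[RHS]/(nu B).
have pmE a b : a < b -> pm `]a, b]%classic = ((Num.max b 0 - Num.max a 0) * A)%:E.
  move=> ab; rewrite -[LHS]/(leb2 (nsq @^-1` `]a, b]%classic)).
  rewrite (_ : _ @^-1` _ = disc b `\` disc a); last first.
    apply/seteqP; split=> w; rewrite /disc/= in_itv/=.
      by move=> /andP[wa ->]; split => //; apply/negP; rewrite -ltNge.
    by move=> [-> /negP]; rewrite -ltNge => ->.
  have -> : leb2 (disc b `\` disc a) = (leb2 (disc b) - leb2 (disc b `&` disc a))%E.
    by apply: (@measureD _ _ _ leb2); [exact: mdisc|exact: mdisc|rewrite [X in (X < _)%E]discE ltry].
  rewrite setIidr; last by move=> w; rewrite /disc/= => /le_trans; apply; exact: ltW.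
  by rewrite !discE -EFinB -mulrBl.
have nuE a b : a < b -> nu `]a, b]%classic = ((Num.max b 0 - Num.max a 0) * A)%:E.
  move=> ab; rewrite -[LHS]/(A%:E * leb (`]a, b]%classic `&` `]0%R, +oo[%classic))%E.
  rewrite (_ : _ `&` _ = `]Num.max a 0, b]%classic); last first.
    apply/seteqP; split=> t; rewrite /= !in_itv/= andbT gt_max.
      by move=> [/andP[-> ->] ->].
    by move=> /andP[/andP[-> ->] ->].
  rewrite lebesgue_measure_itv/= lte_fin gt_max ab/=.
  have [b0|b0] := ltP 0 b; first by rewrite -EFinB -EFinM mulrC.
  by rewrite max_r ?(le_trans (ltW ab))// subrr mule0 mul0r.
refine (@measure_unique _ R RR (@ocitv R) (fun n => `](- n%:R), n%:R]%classic : set RR) _ _ _ _ pm nu _ _ B mB) => //.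
- exact: ocitvI.
- by move=> n; exists (- n%:R, n%:R).
- apply/seteqP; split=> // t _.
  exists (Num.truncn `|t|).+1 => //=; rewrite in_itv/=.
  have := truncnS_gt `|t|; rewrite ltr_norml => /andP[-> h].
  exact: ltW.
- move=> _ /ocitvP[->|[[a b] /= ab ->]]; first by rewrite !measure0.
  by rewrite pmE// nuE.
- case=> [|n].
    by rewrite set_itv_ge ?measure0// bnd_simp oppr0 ltxx.
  by rewrite pmE ?ltry// gtrN.
Qed.

Let radial_A (A : R) (h : R -> R[i]) v : leb2 (disc 1) = A%:E -> 0 < A ->
  cmeas (h : RR -> R[i]) ->
  has_cint leb (fun r => hpow 1 r * h r) v ->
  has_cint leb2 (fun w => h (nsq w)) (A%:C%C * v).
Proof.
move=> hA A0 mh hv.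
apply: (has_cint_image measurable_nsq A0 (nsq_image hA A0)).
apply: has_cint_mrestr => //; apply: has_cint_ext hv => t.
rewrite mem_setE in_itv/= andbT; have [t0|t0] := ltP 0 t.
  by rewrite hpow_gt0// subrr cpowR0 mul1r.
by rewrite hpow_le0// mul0r.
Qed.

(** The function [e^(-|w|^2)] integrates to [A Gamma(1)] radially and to the square of the Gaussian
    integral by Fubini. *)
Let area_pi (A : R) : leb2 (disc 1) = A%:E -> 0 < A -> A = pi.
Proof.
move=> hA A0.
have mexp : cmeas (fun r : RR => (expR (- r))%:C%C).
  by apply: cmeas_real; apply: measurableT_comp.
have h1 : has_cint leb2 (fun w => (expR (- nsq w))%:C%C) (A%:C%C * 1).
  apply: (@radial_A A (fun r => (expR (- r))%:C%C)) => //.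
  by have := @has_cint_gker R 1 ltr01; rewrite cGamma1.
have hg : has_cint leb (fun x => (gauss_fun x)%:C%C) (Num.sqrt pi)%:C%C.
  apply/has_cintE; split => //=.
  - exact: integrableT_gauss.
  - exact: integrable0.
  - exact: integralT_gauss.
  - by rewrite integral0.
have h2 : has_cint leb2 (fun w => (expR (- nsq w))%:C%C) ((Num.sqrt pi)%:C%C * (Num.sqrt pi)%:C%C).
  have inner x : has_cint leb (fun y => (expR (- nsq (x, y)))%:C%C)
      ((gauss_fun x)%:C%C * (Num.sqrt pi)%:C%C).
    apply: has_cint_ext (has_cint_scale _ hg) => y.
    by rewrite -rmorphM/= -expRD /nsq/= opprD.
  have outer := has_cint_scaler (Num.sqrt pi)%:C%C hg.
  apply: (has_cint_fubini _ inner _ outer outer).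
    exact: (cmeas_comp mexp measurable_nsq).
  move=> x; apply: has_cint_ext (inner x) => y.
  by rewrite normrC_ge0// expR_ge0.
have := has_cint_uniq h1 h2.
rewrite mulr1 -rmorphM/= => /complexI ->.
by rewrite -expr2 sqr_sqrtr// pi_ge0.
Qed.

(** Polar coordinates with [r = |w|^2] as radial variable: the Jacobian is then the constant
    [pi]. *)
Lemma has_cint_radial (h : R -> R[i]) v : cmeas (h : RR -> R[i]) ->
  has_cint leb (fun r => hpow 1 r * h r) v ->
  has_cint leb2 (fun w => h (nsq w)) (pi%:C%C * v).
Proof.
have [A A0 hA] := area; rewrite -(area_pi hA A0); exact: radial_A.
Qed.

End plane.

(** * Product measures on tuples *)

Section tuple_rect.
Context {R : realType} {d : measure_display} {T : measurableType d}.
Variable mu : {sigma_finite_measure set T -> \bar R}.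

Definition rect n (A : 'I_n -> set T) : set (n.-tuple T) :=
  [set t | forall i, A i (tnth t i)].

Lemma measurable_rect n (A : 'I_n -> set T) : (forall i, measurable (A i)) ->
  measurable (rect A).
Proof.
move=> mA; rewrite (_ : rect A = \big[setI/setT]_(i < n) ((fun t => tnth t i) @^-1` A i)).
  apply: bigsetI_measurable => i _.
  by rewrite -[X in measurable X]setTI; exact: measurable_tnth.
rewrite -bigcap_seq; apply/seteqP; split=> t /=.
  by move=> At i _ /=; exact: At.
by move=> h i; apply: h; rewrite /= mem_index_enum.
Qed.

Lemma tuple_cons_rect n (A : 'I_n.+1 -> set T) :
  @tuple_cons _ _ n @^-1` rect A = A ord0 `*` rect (fun i => A (lift ord0 i)).
Proof.
apply/seteqP; split=> -[x t] /=.
  move=> h; split; first exact: (h ord0).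
  by move=> i; have := h (lift ord0 i); rewrite /tuple_cons/= tnthS.
move=> [h0 h] i; case: (unliftP ord0 i) => [j ->|-> //].
by rewrite /tuple_cons/= tnthS; exact: h.
Qed.

Lemma tuple_measure_rect n (A : 'I_n -> set T) : (forall i, measurable (A i)) ->
  tuple_measure mu n (rect A) = (\prod_(i < n) mu (A i))%E.
Proof.
elim: n A => [|n IH] A mA.
  rewrite big_ord0 /= diracE mem_set//; by move=> [].
rewrite big_ord_recl -IH//.
have -> : tuple_measure mu n.+1 (rect A) =
   (mu \x tuple_measure mu n)%E (@tuple_cons _ _ n @^-1` rect A) by [].
by rewrite tuple_cons_rect product_measure1E//; exact: measurable_rect.
Qed.

Lemma measurable_tuple_rect n : @measurable _ (n.-tuple T) =
  <<s [set B | exists2 A : 'I_n -> set T, (forall i, measurable (A i)) & B = rect A] >>.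
Proof.
apply/seteqP; split.
  apply: smallest_sub; first exact: smallest_sigma_algebra.
  rewrite -bigcup_seq => B [i _ [C mC <-]]; rewrite setTI.
  apply: sub_sigma_algebra; exists (fun j => if j == i then C else setT).
    by move=> j; case: ifP.
  apply/seteqP; split=> t /=.
    by move=> Ct j; case: eqP => [->|].
  by move=> /(_ i); rewrite eqxx.
apply: smallest_sub; first exact: sigma_algebra_measurable.
by move=> _ [A mA ->]; exact: measurable_rect.
Qed.

(** Rectangles form a generating pi-system, and the cubes over an exhausting sequence of sets of
    finite measure cover the space. *)
Lemma tuple_measure_unique n (m : {measure set (n.-tuple T) -> \bar R}) :
  (forall A : 'I_n -> set T, (forall i, measurable (A i)) ->
     m (rect A) = (\prod_(i < n) mu (A i))%E) ->
  forall X, measurable X -> tuple_measure mu n X = m X.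
Proof.
move=> mE.
have /sigma_finiteP[F [FT ndF Foo]] := sigma_finiteT mu.
have prod_lty (A : 'I_n -> set T) : (forall i, mu (A i) < +oo)%E ->
    (\prod_(i < n) mu (A i) < +oo)%E.
  move=> Aoo; suff [_ //] : (0 <= \prod_(i < n) mu (A i))%E /\
     (\prod_(i < n) mu (A i) < +oo)%E.
  apply: (big_ind (fun x : \bar R => (0 <= x)%E /\ (x < +oo)%E)).
  - by split => //; exact: ltry.
  - move=> x y [x0 xoo] [y0 yoo]; split; first exact: mule_ge0.
    by rewrite lte_mul_pinfty// ge0_fin_numE.
  - by move=> i _; split.
move=> X mX.
refine (@measure_unique _ R _ [set B | exists2 A : 'I_n -> set T, (forall i, measurable (A i)) & B = rect A]
  (fun k => rect (fun=> F k)) _ _ _ _ _ m _ _ X mX).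
- exact: measurable_tuple_rect.
- move=> _ _ [A mA ->] [B mB ->]; exists (fun i => A i `&` B i).
    by move=> i; exact: measurableI.
  by apply/seteqP; split=> t /=; [move=> [h1 h2] i; split|move=> h; split=> i; have [] := h i].
- by move=> k; exists (fun=> F k) => // i; have [] := Foo k.
- apply/seteqP; split=> // t _.
  have tF i : exists k, F k (tnth t i).
    by have : [set: T] (tnth t i) by []; rewrite FT => -[k _ ?]; exists k.
  have /choice[N NF] := tF.
  (* One index serves all coordinates because [F] is nondecreasing. *)
  exists (\max_(i < n) N i)%N => // i /=.
  by move: (NF i); exact/subsetPset/ndF/leq_bigmax.
- by move=> _ [A mA ->]; rewrite mE//; exact: tuple_measure_rect.
- move=> k; rewrite [X in (X < _)%E]tuple_measure_rect; last by move=> i; have [] := Foo k.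
  by apply: prod_lty => i; have [] := Foo k.
Qed.

(** Reduces a substitution on tuples to its effect on rectangles: the pushforward divided by [k] is
    then the product measure by uniqueness. *)
Lemma tuple_measure_image n d' (S : measurableType d') (nu : {measure set S -> \bar R})
   (phi : S -> n.-tuple T) (k : R) : measurable_fun setT phi -> 0 < k ->
  (forall A : 'I_n -> set T, (forall i, measurable (A i)) ->
     nu (phi @^-1` rect A) = (k%:E * \prod_(i < n) mu (A i))%E) ->
  forall X, measurable X -> nu (phi @^-1` X) = (k%:E * tuple_measure mu n X)%E.
Proof.
move=> mphi k0 phiE X mX.
have kV0 : 0 <= k^-1 by rewrite invr_ge0 ltW.
pose pm : {measure set (n.-tuple T) -> \bar R} :=
  mscale (NngNum kV0) (measure_function_pushforward__canonical__measure_function_Measure nu mphi).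
rewrite (@tuple_measure_unique n pm) //.
  rewrite -[pm X]/(k^-1%:E * nu (phi @^-1` X))%E muleA -EFinM mulfV ?mul1e//.
  by rewrite gt_eqF.
move=> A mA; rewrite -[pm _]/(k^-1%:E * nu (phi @^-1` rect A))%E phiE//.
by rewrite muleA -EFinM mulVf ?mul1e// gt_eqF.
Qed.

Definition tuple_mapi n (phi : 'I_n -> T -> T) (t : n.-tuple T) : n.-tuple T :=
  [tuple phi i (tnth t i) | i < n].

Lemma measurable_tuple_mapi n (phi : 'I_n -> T -> T) :
  (forall i, measurable_fun setT (phi i)) -> measurable_fun setT (tuple_mapi phi).
Proof.
move=> mphi; apply/measurable_fun_tnthP => i.
rewrite (_ : _ \o _ = phi i \o (fun t => tnth t i)).
  by apply: measurableT_comp => //; exact: measurable_tnth.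
by apply/funext => t /=; rewrite tnth_mktuple.
Qed.

Lemma tuple_measure_mapi n (phi : 'I_n -> T -> T) (k : R) : 0 < k ->
  (forall i, measurable_fun setT (phi i)) ->
  (forall i A, measurable A -> mu (phi i @^-1` A) = (k%:E * mu A)%E) ->
  forall X, measurable X ->
  tuple_measure mu n (tuple_mapi phi @^-1` X) = ((k ^+ n)%:E * tuple_measure mu n X)%E.
Proof.
move=> k0 mphi phiE; apply: tuple_measure_image.
- exact: measurable_tuple_mapi.
- exact: exprn_gt0.
move=> A mA.
rewrite (_ : _ @^-1` _ = rect (fun i => phi i @^-1` A i)); last first.
  by apply/seteqP; split=> t /= h i; have := h i; rewrite tnth_mktuple.
rewrite [LHS]tuple_measure_rect; last first.
  by move=> i; rewrite -[X in measurable X]setTI; exact: mphi.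
under eq_bigr do rewrite phiE//.
rewrite big_split/=; congr (_ * _)%E.
elim: n {phi mphi phiE A mA} => [|n IH]; first by rewrite big_ord0 expr0.
by rewrite big_ord_recl IH exprS EFinM.
Qed.

End tuple_rect.

(** * Hermitian coordinates split into corner, first row and block *)

Section assemble.
Context {R : realType}.
Local Notation leb := (@lebesgue_measure R).
Local Notation RR := (measurableTypeR R).

(* [z] lists the corner entry, the complex first row and the coordinates of the
   remaining block of a Hermitian matrix. *)
Definition assemble_mx p (z : RR * (p.-tuple (RR * RR) * (p * p).-tuple RR)) : 'M[R]_p.+1 :=
  \matrix_(i, j)
    match unlift ord0 i, unlift ord0 j with
    | None, None => z.1
    | None, Some j' => (tnth z.2.1 j').1
    | Some i', None => (tnth z.2.1 i').2
    | Some i', Some j' => tnth z.2.2 (mxvec_index i' j')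
    end.

Definition assemble p (z : RR * (p.-tuple (RR * RR) * (p * p).-tuple RR)) :
    (p.+1 * p.+1).-tuple RR :=
  [tuple mxvec (assemble_mx z) 0 k | k < p.+1 * p.+1].

Lemma tnth_assemble p (z : RR * (p.-tuple (RR * RR) * (p * p).-tuple RR)) i j :
  tnth (assemble z) (mxvec_index i j) = assemble_mx z i j.
Proof. by rewrite tnth_mktuple mxvecE. Qed.

Lemma measurable_assemble p : measurable_fun setT (@assemble p).
Proof.
apply/measurable_fun_tnthP => k; case/mxvec_indexP: k => i j.
rewrite (_ : _ \o _ = fun z => assemble_mx z i j); last first.
  by apply/funext => z /=; rewrite tnth_assemble.
under eq_fun do rewrite mxE.
case: (unlift ord0 i) => [i'|]; case: (unlift ord0 j) => [j'|].
- apply: (measurableT_comp (measurable_tnth (mxvec_index i' j'))).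
  exact: (measurableT_comp measurable_snd measurable_snd).
- apply: (measurableT_comp measurable_snd).
  apply: (measurableT_comp (measurable_tnth i')).
  exact: (measurableT_comp measurable_fst measurable_snd).
- apply: (measurableT_comp measurable_fst).
  apply: (measurableT_comp (measurable_tnth j')).
  exact: (measurableT_comp measurable_fst measurable_snd).
- exact: measurable_fst.
Qed.

Definition vec_lebesgue p := tuple_measure (@leb2 R) p.

Definition assemble_measure p : {sigma_finite_measure set _ -> \bar R} :=
  sfprod leb (sfprod (vec_lebesgue p) (@herm_lebesgue R p)).

Lemma prod_mxvec_index m n (F : 'I_(m * n) -> \bar R) :
  (\prod_k F k = \prod_i \prod_j F (mxvec_index i j))%E.
Proof.
by rewrite (reindex _ (curry_mxvec_bij m n))/= pair_bigA; apply: eq_bigr => -[].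
Qed.

(** The real coordinates are merely regrouped, with [(0, j)] and [(j, 0)] paired into a planar
    point; a rectangle pulls back to a product of rectangles, whence the factor 1. *)
Lemma assemble_measureE p (X : set ((p.+1 * p.+1).-tuple RR)) : measurable X ->
  @assemble_measure p (@assemble p @^-1` X) = (1%:E * @herm_lebesgue R p.+1 X)%E.
Proof.
apply: tuple_measure_image => //; first exact: measurable_assemble.
move=> A mA; rewrite mul1e.
pose A' i j := A (mxvec_index i j).
pose B : 'M[set RR]_p := \matrix_(i, j) A' (lift ord0 i) (lift ord0 j).
have mB k : measurable (mxvec B 0 k).
  by case/mxvec_indexP: k => i j; rewrite mxvecE mxE; exact: mA.
rewrite (_ : _ @^-1` _ = A' ord0 ord0 `*`
   (rect (fun j => A' ord0 (lift ord0 j) `*` A' (lift ord0 j) ord0)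
   `*` rect (mxvec B 0))); last first.
  apply/seteqP; split=> -[x [u c]] /= h.
    split; first by have := h (mxvec_index ord0 ord0); rewrite tnth_assemble mxE unlift_none.
    split=> [j|k]; first split.
    - by have := h (mxvec_index ord0 (lift ord0 j)); rewrite tnth_assemble mxE unlift_none liftK.
    - by have := h (mxvec_index (lift ord0 j) ord0); rewrite tnth_assemble mxE unlift_none liftK.
    - case/mxvec_indexP: k => i j.
      by have := h (mxvec_index (lift ord0 i) (lift ord0 j)); rewrite tnth_assemble !mxE !liftK mxvecE mxE.
  move: h => [h0 [h1 h2]] k; case/mxvec_indexP: k => i j; rewrite tnth_assemble mxE.
  case: (unliftP ord0 i) => [i' ->|->]; case: (unliftP ord0 j) => [j' ->|->].
  - by have := h2 (mxvec_index i' j'); rewrite mxvecE mxE.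
  - by have [] := h1 i'.
  - by have [] := h1 j'.
  - exact: h0.
have mR1 : measurable (rect (fun j => A' ord0 (lift ord0 j) `*` A' (lift ord0 j) ord0)).
  by apply: measurable_rect => j; apply: measurableX; exact: mA.
have mR2 : measurable (rect (mxvec B 0)) by exact: measurable_rect.
rewrite [LHS]product_measure1E; [|exact: mA|exact: measurableX].
rewrite [X in (_ * X)%E]product_measure1E//.
rewrite [X in (_ * (X * _))%E]tuple_measure_rect; last first.
  by move=> j; apply: measurableX; exact: mA.
rewrite [X in (_ * (_ * X))%E]tuple_measure_rect//.
rewrite (eq_bigr (fun j => leb (A' ord0 (lift ord0 j)) * leb (A' (lift ord0 j) ord0))%E);
  last by move=> j _; apply: leb2_rect; exact: mA.
rewrite big_split/= !prod_mxvec_index big_ord_recl big_ord_recl.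
rewrite [X in _ = (_ * X)%E](eq_bigr (fun i => leb (A' (lift ord0 i) ord0) *
  \prod_(j < p) leb (A' (lift ord0 i) (lift ord0 j)))%E); last first.
  by move=> i _; rewrite big_ord_recl.
rewrite big_split/= -!muleA; congr (_ * (_ * (_ * _)))%E.
by apply: eq_bigr => i _; apply: eq_bigr => j _; rewrite mxvecE mxE.
Qed.

Lemma hermx_assemble p x (u : p.-tuple (RR * RR)) (c : (p * p).-tuple RR) i j :
  hermx (assemble (x, (u, c))) i j =
    match unlift ord0 i, unlift ord0 j with
    | None, None => Complex x 0
    | None, Some j' => Complex (tnth u j').1 (tnth u j').2
    | Some i', None => Complex (tnth u i').1 (- (tnth u i').2)
    | Some i', Some j' => hermx c i' j'
    end.
Proof.
have L (a b : 'I_p) : (lift ord0 a < lift ord0 b)%N = (a < b)%N by rewrite !lift0 ltnS.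
rewrite !mxE !tnth_assemble !mxE.
case: (unliftP ord0 i) => [i' ->|->]; case: (unliftP ord0 j) => [j' ->|->] //.
by rewrite !mxE !L.
Qed.

End assemble.

(** * Complex powers of the determinant *)

Section power_of_det.
Context {R : realType}.
Implicit Types (a b : R[i]).

Lemma conjcD (x y : R[i]) : (x + y)^*%C = x^*%C + y^*%C.
Proof. exact: rmorphD. Qed.

Lemma conjcB (x y : R[i]) : (x - y)^*%C = x^*%C - y^*%C.
Proof. exact: rmorphB. Qed.

Lemma conjcM (x y : R[i]) : (x * y)^*%C = x^*%C * y^*%C.
Proof. exact: rmorphM. Qed.

(** The Schur complement of the corner when [M] is Hermitian: the first column is read off as the
    conjugate of the first row, and the corner as its real part. *)
Definition schur p (M : 'M[R[i]]_p.+1) : 'M[R[i]]_p :=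
  \matrix_(i, j) (M (lift ord0 i) (lift ord0 j) -
    (M ord0 (lift ord0 i))^*%C * M ord0 (lift ord0 j) / (complex.Re (M ord0 ord0))%:C%C).

(* For Hermitian [M], this is [|det M|^(a - p)] if [M] is positive definite and 0
   otherwise; the elimination of the first row and column turns that support
   condition into the positivity of successive pivots. *)
Fixpoint detpow p a : 'M[R[i]]_p -> R[i] :=
  match p return 'M[R[i]]_p -> R[i] with
  | 0 => fun=> 1
  | q.+1 => fun M => hpow (a - q%:R) (complex.Re (M ord0 ord0)) * detpow (a - 1) (schur M)
  end.

Lemma normr_detpow p a (M : 'M[R[i]]_p) : `|detpow a M| = detpow (rpart a) M.
Proof.
elim: p a M => [|p IH] a M /=; first by rewrite normr1.
by rewrite normrM normr_hpow IH !rpartB rpart_nat rpartR.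
Qed.

Lemma measurable_invr : measurable_fun setT (fun x : measurableTypeR R => x^-1 : measurableTypeR R).
Proof.
rewrite (_ : (fun x => _) = fun x : R => x * (x ^+ 2) `^ (-1)).
  apply: measurable_funM => //.
  apply: (@measurableT_comp _ _ _ _ _ _ (fun y : R => y `^ (-1))).
    exact: measurable_powR.
  exact: measurable_funX.
apply/funext => x; rewrite powR_inv1 ?sqr_ge0//.
have [->|x0] := eqVneq x 0; first by rewrite invr0 mul0r.
by field.
Qed.

Lemma cmeas_schur d (T : measurableType d) p (M : T -> 'M[R[i]]_p.+1) :
  (forall i j, cmeas (fun t => M t i j)) ->
  forall i j, cmeas (fun t => schur (M t) i j).
Proof.
move=> mM i j; under eq_fun do rewrite mxE -fmorphV.
apply: cmeasB => //; apply: cmeasM; first by apply: cmeasM => //; exact: cmeas_conj.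
apply: cmeas_real; apply: (measurableT_comp measurable_invr).
exact: cmeas_Re (mM _ _).
Qed.

Lemma cmeas_detpow d (T : measurableType d) p a (M : T -> 'M[R[i]]_p) :
  (forall i j, cmeas (fun t => M t i j)) -> cmeas (fun t => detpow a (M t)).
Proof.
elim: p a M => [|p IH] a M mM /=; first exact: cmeas_cst.
apply: cmeasM; last by apply: IH; exact: cmeas_schur.
apply: (cmeas_comp (cmeas_hpow _)).
exact: cmeas_Re (mM _ _).
Qed.

Definition herm p (M : 'M[R[i]]_p) := forall i j, M i j = (M j i)^*%C.

Lemma hermsymmxP p (M : 'M[R[i]]_p) : M \is hermsymmx <-> herm M.
Proof.
split.
  move=> /is_hermitianmxP; rewrite expr0 scale1r => h i j.
  by rewrite {1}h !mxE.
move=> h; apply/is_hermitianmxP; rewrite expr0 scale1r.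
by apply/matrixP => i j; rewrite !mxE h.
Qed.

Lemma herm_schur p (M : 'M[R[i]]_p.+1) : herm M -> herm (schur M).
Proof.
move=> h i j; rewrite !mxE conjcB !conjcM conjcK conjc_inv conjc_real.
by rewrite -(h (lift ord0 i) (lift ord0 j)) (mulrC (M ord0 (lift ord0 j))).
Qed.

Lemma herm_diag p (M : 'M[R[i]]_p) i : herm M -> M i i = (complex.Re (M i i))%:C%C.
Proof.
move=> h; have := h i i; case: (M i i) => x y /= [] /eqP.
rewrite -subr_eq0 opprK -mulr2n mulrn_eq0/= => /eqP ->.
by [].
Qed.

Definition qform p (M : 'M[R[i]]_p) (u : 'rV[R[i]]_p) : R[i] :=
  \sum_i \sum_j u 0 i * M i j * (u 0 j)^*%C.

Lemma qformE p (M : 'M[R[i]]_p) u : (u *m M *m u ^t*)%sesqui 0 0 = qform M u.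
Proof.
rewrite mxE /qform exchange_big/=; apply: eq_bigr => j _.
by rewrite !mxE mulr_suml; apply: eq_bigr.
Qed.

(* Completing the square in the first coordinate. *)
Lemma qform_schur p (M : 'M[R[i]]_p.+1) (u : 'rV[R[i]]_p.+1) : herm M ->
  complex.Re (M ord0 ord0) != 0 ->
  qform M u =
  (complex.Re (M ord0 ord0))%:C%C *
    `|u 0 ord0 + (\sum_j u 0 (lift ord0 j) * (M ord0 (lift ord0 j))^*%C) /
       (complex.Re (M ord0 ord0))%:C%C| ^+ 2
  + qform (schur M) (\row_j u 0 (lift ord0 j)).
Proof.
move=> h x0; set x : R[i] := (complex.Re _)%:C%C.
have xn0 : x != 0 by apply: contraNneq x0 => /complexI ->.
set s := \sum_j _; set a := u 0 ord0.
have xE : M ord0 ord0 = x by exact: herm_diag.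
have xJ : x^*%C = x by exact: conjc_real.
have sJ : s^*%C = \sum_j M ord0 (lift ord0 j) * (u 0 (lift ord0 j))^*%C.
  by rewrite rmorph_sum; apply: eq_bigr => j _; rewrite rmorphM/= conjcK mulrC.
pose Q := \sum_(i < p) \sum_(j < p) u 0 (lift ord0 i) * M (lift ord0 i) (lift ord0 j) *
   (u 0 (lift ord0 j))^*%C.
have -> : qform (schur M) (\row_j u 0 (lift ord0 j)) = Q - s * s^*%C / x.
  rewrite sJ /s mulr_suml mulr_suml -sumrB; apply: eq_bigr => i _.
  rewrite mulr_sumr mulr_suml -sumrB; apply: eq_bigr => j _.
  by rewrite !mxE -/x; ring.
have -> : qform M u = x * (a * a^*%C) + a * s^*%C + s * a^*%C + Q.
  rewrite /qform big_ord_recl big_ord_recl -/a xE.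
  rewrite (eq_bigr (fun j => a * (M ord0 (lift ord0 j) * (u 0 (lift ord0 j))^*%C))); last first.
    by move=> j _; rewrite mulrA.
  rewrite -mulr_sumr -sJ.
  rewrite (eq_bigr (fun i => u 0 (lift ord0 i) * (M ord0 (lift ord0 i))^*%C * a^*%C +
     \sum_(j < p) u 0 (lift ord0 i) * M (lift ord0 i) (lift ord0 j) *
        (u 0 (lift ord0 j))^*%C)); last first.
    by move=> i _; rewrite big_ord_recl -h.
  by rewrite big_split/= -mulr_suml -/s -/Q; ring.
rewrite sqr_normc conjcD conjcM conjc_inv xJ.
by field.
Qed.

Lemma posdefmxE p (M : 'M[R[i]]_p) : posdefmx M <->
  herm M /\ forall u, u != 0 -> 0 < qform M u.
Proof.
split=> -[h1 h2]; split.
- exact/hermsymmxP.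
- by move=> u u0; rewrite -qformE; exact: h2.
- exact/hermsymmxP.
- by move=> u u0; rewrite qformE; exact: h2.
Qed.

Lemma posdefmx_schur p (M : 'M[R[i]]_p.+1) : herm M ->
  posdefmx M <-> 0 < complex.Re (M ord0 ord0) /\ posdefmx (schur M).
Proof.
move=> hM.
pose ext (a : R[i]) (u : 'rV[R[i]]_p) : 'rV[R[i]]_p.+1 :=
  \row_j if unlift ord0 j is Some j' then u 0 j' else a.
have ext0 a u : ext a u 0 ord0 = a by rewrite mxE unlift_none.
have extS a u j : ext a u 0 (lift ord0 j) = u 0 j by rewrite mxE liftK.
have extR a u : \row_j ext a u 0 (lift ord0 j) = u.
  by apply/rowP => j; rewrite mxE extS.
split.
  move=> /posdefmxE[_ pM].
  have x0 : 0 < complex.Re (M ord0 ord0).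
    have := pM (delta_mx 0 ord0); rewrite /qform (bigD1 ord0)//= (bigD1 ord0)//=.
    rewrite big1 ?addr0; last by move=> j j0; rewrite !mxE (negbTE j0) conjc0 mulr0.
    rewrite big1 ?addr0; last first.
      by move=> i i0; rewrite big1// => j _; rewrite !mxE (negbTE i0) !mul0r.
    rewrite !mxE !eqxx conjc1 mul1r mulr1 (herm_diag _ hM) ltcR; apply.
    by apply/rV0Pn; exists ord0; rewrite !mxE !eqxx oner_eq0.
  split=> //; apply/posdefmxE; split; first exact: herm_schur.
  move=> u u0; set x := complex.Re _ in x0.
  (* The first coordinate that makes the completed square in [qform_schur] vanish, leaving the form
     of the Schur complement. *)
  pose a := - (\sum_j u 0 j * (M ord0 (lift ord0 j))^*%C) / x%:C%C.
  have := pM (ext a u); rewrite qform_schur ?gt_eqF// extR ext0.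
  under eq_bigr do rewrite extS.
  rewrite /a mulNr addNr normr0 expr0n/= mulr0 add0r; apply.
  apply: contraNneq u0 => e.
  apply/eqP/rowP => j; have := congr1 (fun v : 'rV[R[i]]_p.+1 => v 0 (lift ord0 j)) e.
  by rewrite /= extS !mxE.
move=> [x0 /posdefmxE[_ pS]]; apply/posdefmxE; split=> // u u0.
rewrite qform_schur ?gt_eqF//.
set x := complex.Re _ in x0 *.
have xC : 0 < x%:C%C :> R[i] by rewrite ltcR.
have [u'0|u'0] := eqVneq (\row_j u 0 (lift ord0 j)) 0; last first.
  apply: ltr_wpDl; last exact: pS.
  by apply: mulr_ge0; [exact: ltW|apply: exprn_ge0].
have uS j : u 0 (lift ord0 j) = 0 by move/rowP/(_ j): u'0; rewrite !mxE.
rewrite u'0 big1 ?mul0r ?addr0; last by move=> j _; rewrite uS mul0r.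
rewrite [qform _ 0]big1 ?addr0; last first.
  by move=> i _; rewrite big1// => j _; rewrite !mxE !mul0r.
rewrite mulr_gt0 ?exprn_gt0 ?normr_gt0//.
apply: contraNneq u0 => e; apply/eqP/rowP => j; rewrite mxE.
by case: (unliftP ord0 j) => [j' ->|->].
Qed.

Lemma det_schur p (M : 'M[R[i]]_p.+1) : herm M -> complex.Re (M ord0 ord0) != 0 ->
  \det M = (complex.Re (M ord0 ord0))%:C%C * \det (schur M).
Proof.
move=> h x0; set x : R[i] := (complex.Re _)%:C%C.
have xn0 : x != 0 by apply: contraNneq x0 => /complexI ->.
have xE : M ord0 ord0 = x by exact: herm_diag.
pose N : 'M[R[i]]_(1 + p) := M.
have r1 (j : 'I_p) : rshift 1 j = lift ord0 j by exact/val_inj.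
have l1 : lshift p (ord0 : 'I_1) = ord0 by exact/val_inj.
have ulE : ulsubmx N = x%:M.
  by rewrite [LHS]mx11_scalar !mxE l1 xE.
(* Unimodular column operations that clear the first row to the right of the corner; the remaining
   block becomes the Schur complement. *)
pose U : 'M[R[i]]_(1 + p) := block_mx 1%:M (- x^-1 *: ursubmx N) 0 1%:M.
have dU : \det U = 1 by rewrite det_ublock !det1 mulr1.
have -> : \det M = \det (N *m U) by rewrite det_mulmx dU mulr1.
rewrite -(submxK N) mulmx_block !mulmx1 !mulmx0 !addr0.
rewrite ulE mul_scalar_mx scalerA mulrN mulfV// scaleN1r addNr det_lblock det_scalar1.
congr (_ * \det _); apply/matrixP => i j.
rewrite !mxE big_ord1 !mxE !r1 l1 [M (lift ord0 i) ord0]h -/x addrC.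
by congr (_ + _); ring.
Qed.

Lemma absdet_schur p (M : 'M[R[i]]_p.+1) : herm M -> 0 < complex.Re (M ord0 ord0) ->
  absdet M = complex.Re (M ord0 ord0) * absdet (schur M).
Proof.
move=> h x0; rewrite /absdet det_schur ?gt_eqF// Normc.normcM /=.
by rewrite expr0n addr0 sqrtr_sqr ger0_norm ?ltW.
Qed.

Lemma posdefmx_absdet p (M : 'M[R[i]]_p) : posdefmx M -> 0 < absdet M.
Proof.
elim: p M => [|p IH] M pM.
  by rewrite /absdet det_mx00 Normc.normc1.
have hM : herm M by case/posdefmxE: pM.
have [x0 pS] := (posdefmx_schur hM).1 pM.
by rewrite absdet_schur// mulr_gt0// IH.
Qed.

Lemma detpowE p a (M : 'M[R[i]]_p) : herm M ->
  detpow a M = if `[< posdefmx M >] then cpowR (absdet M) (a - p%:R) else 0.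
Proof.
elim: p a M => [|p IH] a M hM /=.
  rewrite ifT; last first.
    apply/asboolP/posdefmxE; split=> // u; rewrite (_ : u = 0) ?eqxx//.
    by apply/rowP => -[].
  by rewrite /absdet det_mx00 Normc.normc1 cpowR1.
rewrite (IH _ _ (herm_schur hM)).
have E := posdefmx_schur hM.
case: ifPn => [/asboolP pS|nS]; last first.
  rewrite mulr0 ifF//; apply/negbTE; apply: contra nS => /asboolP/E[_ ?].
  exact/asboolP.
have [x0|x0] := ltP 0 (complex.Re (M ord0 ord0)); last first.
  rewrite hpow_le0// mul0r ifF//; apply/negbTE/asboolP => /E[].
  by rewrite ltNge x0.
rewrite ifT; last by apply/asboolP/E.
rewrite absdet_schur// cpowRM ?posdefmx_absdet// hpow_gt0//.
by rewrite -natr1; congr (cpowR _ _ * cpowR _ _); ring.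
Qed.

End power_of_det.

(** * Integrals over rank-one perturbations *)

(** Base case of the inductions on the size and on the number of matrices: 0-tuples carry a Dirac
    measure. *)
Lemma has_cint_dirac {R : realType} d (T : measurableType d) (a : T) (f : T -> R[i]) :
  cmeas f -> has_cint \d_a f (f a).
Proof.
move=> mf; have [m1 m2] := mf; have mn := cmeas_norm mf.
have E (g : T -> R) : measurable_fun setT g -> (\int[\d_a]_x (g x)%:E = (g a)%:E)%E.
  move=> mg; rewrite integral_dirac//; last exact/measurable_EFinP.
  by rewrite diracE mem_set// mul1e.
have [i1 i2] : cintegrable \d_a setT f.
  by apply: cintegrable_norm => //; rewrite E// ltry.
by apply/has_cintE; split => //; exact: E.
Qed.

Lemma has_cint_tuple_cons {R : realType} d (T : measurableType d)
    (mu : {sigma_finite_measure set T -> \bar R}) n (f : n.+1.-tuple T -> R[i]) v :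
  cmeas f ->
  has_cint (mu \x tuple_measure mu n)%E (fun z => f (tuple_cons z)) v ->
  has_cint (tuple_measure mu n.+1) f v.
Proof.
move=> mf hf.
have := @has_cint_preimage _ _ _ _ _ (mu \x tuple_measure mu n)%E
  (tuple_measure mu n.+1) (@tuple_cons _ _ n) (@measurable_tuple_cons _ _ n) 1 ltr01.
rewrite invr1 => h; rewrite -[v]mul1r; apply: h => //.
by move=> A mA; rewrite mul1e.
Qed.

Section rank_one.
Context {R : realType}.
Local Notation leb := (@lebesgue_measure R).
Local Notation RR := (measurableTypeR R).
Implicit Types (a b z : R[i]) (s t x : R).

Definition cplx (w : RR * RR) : R[i] := Complex w.1 w.2.

Lemma cmeas_cplx : cmeas cplx.
Proof. by split; [exact: measurable_fst|exact: measurable_snd]. Qed.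

Definition vcplx p (w : p.-tuple (RR * RR)) (j : 'I_p) : R[i] := cplx (tnth w j).

Lemma cmeas_vcplx p (j : 'I_p) : cmeas (fun w => vcplx w j).
Proof. exact: (cmeas_comp cmeas_cplx (measurable_tnth j)). Qed.

Definition outer p (w : 'I_p -> R[i]) : 'M[R[i]]_p := \matrix_(i, j) ((w i)^*%C * w j).

Lemma herm_outer p (w : 'I_p -> R[i]) : herm (outer w).
Proof. by move=> i j; rewrite !mxE conjcM conjcK mulrC. Qed.

Lemma outerZ p (r : R) (w : 'I_p -> R[i]) : outer (fun j => r%:C%C * w j) = (r ^+ 2)%:C%C *: outer w.
Proof.
apply/matrixP => i j; rewrite !mxE conjcM conjc_real rmorphXn/=; ring.
Qed.

Lemma has_cint_vec_affine p (c : R) (b : 'I_p -> R[i])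
    (f : ('I_p -> R[i]) -> R[i]) v : 0 < c ->
  has_cint (@vec_lebesgue R p) (fun w => f (vcplx w)) v ->
  has_cint (@vec_lebesgue R p) (fun w => f (fun j => c%:C%C * vcplx w j + b j))
    (((c ^- 2) ^+ p)%:C%C * v).
Proof.
move=> c0 hf.
pose phi j := aff2 c (complex.Re (b j), complex.Im (b j)).
have c2 : 0 < c ^- 2 by rewrite invr_gt0 exprn_gt0.
have mphi j : measurable_fun setT (phi j) by exact: measurable_aff2.
have phiE j A : measurable A -> leb2 (phi j @^-1` A) = ((c ^- 2)%:E * leb2 A)%E.
  by move=> mA; exact: leb2_aff.
have := has_cint_image (measurable_tuple_mapi mphi) (exprn_gt0 p c2)
   (tuple_measure_mapi c2 mphi phiE) hf.
apply: has_cint_ext => w /=; congr f; apply/funext => j.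
rewrite /vcplx tnth_mktuple /phi /aff2 /cplx/=.
by case: (b j) => x y; apply: complex_ext; rewrite ?cReD ?cImD ?cReZ ?cImZ.
Qed.

(** Completing the square in the coordinates of [w] after the first: the perturbation and the
    elimination contribute rank-one terms with total coefficient [1 + |w_0|^2 / q = t / q]. *)
Lemma schur_rank_one p (T : 'M[R[i]]_p.+1) (w : 'I_p.+1 -> R[i]) :
  let t := complex.Re (T ord0 ord0) in
  let q := t - complex.Re (`|w ord0| ^+ 2) in
  t != 0 -> q != 0 ->
  schur (T - outer w) = schur T - (t / q)%:C%C *:
    outer (fun j => w (lift ord0 j) - w ord0 / t%:C%C * T ord0 (lift ord0 j)).
Proof.
move=> t q t0 q0; apply/matrixP => i j; rewrite !mxE.
have n2 : w ord0 * (w ord0)^*%C = (complex.Re (`|w ord0| ^+ 2))%:C%C.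
  by rewrite sqr_normc; case: (w ord0) => x y; apply: complex_ext => /=; ring.
have -> : complex.Re (T ord0 ord0 - (w ord0)^*%C * w ord0) = q.
  by rewrite cReD cReN mulrC n2.
have tq : t%:C%C = q%:C%C + w ord0 * (w ord0)^*%C.
  by rewrite n2 -rmorphD/= subrK.
have tn : t%:C%C != 0 :> R[i] by apply: contraNneq t0 => /complexI ->.
have qn : q%:C%C != 0 :> R[i] by apply: contraNneq q0 => /complexI ->.
rewrite !conjcB !conjcM !conjc_inv !conjcK !conjc_real (rmorphM _ t) fmorphV/=.
rewrite -/t.
move: tq tn qn; move: (t%:C%C) (q%:C%C) => {t q t0 q0 n2} t q.
move: (w ord0) ((w ord0)^*%C) => w0 w0c tq tn qn.
by rewrite tq in tn *; field; rewrite ?qn ?tn.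
Qed.

(** Completing the square in the first row of [X]: its coefficient is
    [1 / x + 1 / (s - x) = s / (x (s - x))], and the minimum, at [x / s] times the first row of [S],
    accounts for [schur S]. *)
Lemma schur_sum p (S X : 'M[R[i]]_p.+1) :
  let s := complex.Re (S ord0 ord0) in
  let x := complex.Re (X ord0 ord0) in
  x != 0 -> s - x != 0 -> s != 0 ->
  schur (S - X) + schur X = schur S - (s / (x * (s - x)))%:C%C *:
    outer (fun j => X ord0 (lift ord0 j) - (x / s)%:C%C * S ord0 (lift ord0 j)).
Proof.
move=> s x x0 sx0 s0; apply/matrixP => i j; rewrite !mxE.
have -> : complex.Re (S ord0 ord0 - X ord0 ord0) = s - x by rewrite cReD cReN.
rewrite -/s -/x !conjcB !conjcM !conjc_real.
rewrite !rmorphM/= !fmorphV/= !rmorphM/= !rmorphB/=.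
have xn : x%:C%C != 0 :> R[i] by apply: contraNneq x0 => /complexI ->.
have sn : s%:C%C != 0 :> R[i] by apply: contraNneq s0 => /complexI ->.
have sxn : s%:C%C - x%:C%C != 0 :> R[i].
  by rewrite -rmorphB/=; apply: contraNneq sx0 => /complexI ->.
move: xn sn sxn; move: (s%:C%C) (x%:C%C) => {s x x0 s0 sx0} s x xn sn sxn.
by field; rewrite xn sn sxn.
Qed.

Lemma detpowS p a (M : 'M[R[i]]_p.+1) : detpow a M =
  hpow (a - p%:R) (complex.Re (M ord0 ord0)) * detpow (a - 1) (schur M).
Proof. by []. Qed.

(** One planar integral, worth [pi / (b - i)], for each coordinate; the parameter drops by 1 at each
    elimination. *)
Definition rank_one_const p (b : R[i]) : R[i] := \prod_(i < p) ((pi%:C%C) / (b - i%:R)).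

Lemma rank_one_constS p b : rank_one_const p.+1 b = pi%:C%C / b * rank_one_const p (b - 1).
Proof.
rewrite /rank_one_const big_ord_recl subr0; congr (_ * _); apply: eq_bigr => i _.
by rewrite lift0 -natr1; congr (_ / _); ring.
Qed.

Lemma has_cint_bker_refl a b s v : has_cint leb (bker a b s) v -> has_cint leb (bker b a s) v.
Proof.
move=> /(has_cint_refl s); apply: has_cint_ext => t.
by rewrite /bker mulrC; congr (_ * hpow _ _); ring.
Qed.

Lemma has_cint_ball b t : 0 < complex.Re b ->
  has_cint (@leb2 R) (fun w => hpow b (t - nsq w)) (pi%:C%C / b * hpow (b + 1) t).
Proof.
move=> b0; rewrite -mulrA.
apply: (@has_cint_radial R (fun r => hpow b (t - r))).
  by apply: (cmeas_comp (cmeas_hpow b)); exact: measurable_funB.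
exact/has_cint_bker_refl/has_cint_bker_1.
Qed.

Lemma nsqE (w : RR * RR) : nsq w = complex.Re (`|cplx w| ^+ 2).
Proof.
by rewrite sqr_normc /cplx /nsq /=; ring.
Qed.

Lemma hpow_exp a s n : 0 < s -> hpow a s * s%:C%C ^+ n = hpow (a + n%:R) s.
Proof. by move=> s0; rewrite -cpowR_nat// hpowM. Qed.

(* Integrating out the first coordinate of [w] reduces the dimension, since
   the Schur complement of [T - w^* w] is [schur T] minus a rank-one matrix in
   an affine image of the remaining coordinates. *)
Lemma has_cint_rank_one p b (T : 'M[R[i]]_p) :
  (forall i, (i < p)%N -> i%:R < complex.Re b) ->
  has_cint (@vec_lebesgue R p) (fun w => detpow b (T - outer (vcplx w)))
    (rank_one_const p b * detpow (b + 1) T).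
Proof.
elim: p b T => [|p IH] b T hb.
  rewrite /rank_one_const big_ord0 mul1r; exact: (has_cint_dirac _ (cmeas_cst 1)).
set t := complex.Re (T ord0 ord0).
pose f b (z : (RR * RR) * p.-tuple (RR * RR)) := detpow b (T - outer (vcplx (tuple_cons z))).
have vS (z : (RR * RR) * p.-tuple (RR * RR)) j : vcplx (tuple_cons z) (lift ord0 j) = vcplx z.2 j.
  by rewrite /vcplx /tuple_cons tnthS.
have v0 (z : (RR * RR) * p.-tuple (RR * RR)) : vcplx (tuple_cons z) ord0 = cplx z.1 by [].
have mo b' : cmeas (fun w : p.+1.-tuple (RR * RR) => detpow b' (T - outer (vcplx w))).
  apply: cmeas_detpow => i j; under eq_fun do rewrite !mxE.
  apply: cmeasB; first exact: cmeas_cst.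
  by apply: cmeasM; [apply: cmeas_conj|]; exact: cmeas_vcplx.
pose K b := (t^-1 ^+ p)%:C%C * (rank_one_const p (b - 1) * detpow b (schur T)).
have inner b' (hb' : forall i, (i < p.+1)%N -> i%:R < complex.Re b') w1 :
    has_cint (@vec_lebesgue R p) (fun w => f b' (w1, w)) (hpow b' (t - nsq w1) * K b').
  set q := t - nsq w1.
  have qE : q = t - complex.Re (`|vcplx (tuple_cons (w1, point)) ord0| ^+ 2).
    by rewrite /q nsqE.
  have q00 w : complex.Re ((T - outer (vcplx (tuple_cons (w1, w)))) ord0 ord0) = q.
    rewrite !mxE cReD cReN v0 /q nsqE sqr_normc.
    by congr (_ - complex.Re _); rewrite mulrC.
  have [q0|q0] := ltP 0 q; last first.
    rewrite hpow_le0// mul0r; apply: has_cint_ext (has_cint0 _) => w.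
    by rewrite /f detpowS q00 hpow_le0// mul0r.
  have t0 : 0 < t.
    apply: lt_le_trans q0 _; rewrite /q gerBl /nsq.
    by rewrite addr_ge0 ?sqr_ge0.
  (* Rescaling the remaining coordinates by [c] absorbs the coefficient [t / q] of the rank-one
     term. *)
  pose c := Num.sqrt (t / q).
  have c0 : 0 < c by rewrite sqrtr_gt0 divr_gt0.
  have cV2 : c ^- 2 = q / t by rewrite sqr_sqrtr ?divr_ge0 ?ltW// invf_div.
  have hIH : has_cint (@vec_lebesgue R p) (fun w => detpow (b' - 1) (schur T - outer (vcplx w)))
      (rank_one_const p (b' - 1) * detpow b' (schur T)).
    have := IH (b' - 1) (schur T); rewrite subrK; apply=> i ip.
    have := hb' i.+1 ip; rewrite -natr1 cReD cReN [complex.Re 1]/=; lra.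
  pose bb (j : 'I_p) := - (c%:C%C * (cplx w1 / t%:C%C * T ord0 (lift ord0 j))).
  have := has_cint_scale (hpow (b' - p%:R) q) (@has_cint_vec_affine p c bb
    (fun u => detpow (b' - 1) (schur T - outer u)) _ c0 hIH).
  rewrite cV2 => h.
  (* The Jacobian is [(q / t)^p]: its numerator raises the exponent of [q] by [p], and [t^(-p)] goes
     into [K]. *)
  have -> : hpow b' q * K b' = hpow (b' - p%:R) q *
     (((q / t) ^+ p)%:C%C * (rank_one_const p (b' - 1) * detpow b' (schur T))).
    rewrite /K !mulrA; congr (_ * _ * _).
    by rewrite exprMn rmorphM/= mulrA; congr (_ * _); rewrite rmorphXn/= hpow_exp// subrK.
  apply: has_cint_ext h => w; rewrite /f detpowS q00; congr (_ * detpow _ _).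
  rewrite schur_rank_one ?gt_eqF//; last first.
    by rewrite v0 -nsqE.
  rewrite v0 -/t -nsqE -/q; congr (_ - _).
  have -> : t / q = c ^+ 2 by rewrite sqr_sqrtr// divr_ge0 ?ltW.
  rewrite -outerZ; congr outer; apply/funext => j.
  by rewrite vS /bb mulrBr.
have outerint b' (hb' : forall i, (i < p.+1)%N -> i%:R < complex.Re b') :
    has_cint (@leb2 R) (fun w1 => hpow b' (t - nsq w1) * K b')
      (pi%:C%C / b' * hpow (b' + 1) t * K b').
  by apply: has_cint_scaler; apply: has_cint_ball; exact: (hb' 0%N).
have -> : rank_one_const p.+1 b * detpow (b + 1) T = pi%:C%C / b * hpow (b + 1) t * K b.
  rewrite rank_one_constS detpowS -/t addrK /K.
  have [t0|t0] := ltP 0 t; last by rewrite !(@hpow_le0 _ _ t)// !(mulr0, mul0r).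
  (* The factor [t^(-p)] in [K] lowers the power of [t] to the one in [detpow (b + 1) T]. *)
  rewrite -{2}(subrK p%:R (b + 1)) -hpow_exp// exprVn fmorphV rmorphXn/=.
  field.
  rewrite expf_neq0//=.
    by apply: contraTneq (hb 0%N isT) => ->; rewrite ltxx.
  by apply: contraTneq t0 => /complexI ->; rewrite ltxx.
apply: has_cint_tuple_cons; first exact: mo.
apply: (@has_cint_fubini R _ _ _ _ (@leb2 R) (@vec_lebesgue R p) (f b) _ _ _ _ _
   (inner b hb) _ (outerint b hb) (outerint (rpart b) hb)).
  exact: (cmeas_comp (mo b) (@measurable_tuple_cons _ _ p)).
move=> w1; apply: has_cint_ext (inner (rpart b) hb w1) => w.
by rewrite /f normr_detpow.
Qed.

End rank_one.

(** * Convolution of powers of determinants *)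

Section convolution.
Context {R : realType}.
Local Notation leb := (@lebesgue_measure R).
Local Notation RR := (measurableTypeR R).
Implicit Types (a b : R[i]) (s x : R).

Lemma cmeas_hermx p i j : cmeas (fun c : (p * p).-tuple RR => hermx c i j).
Proof.
have mt k : measurable_fun setT (fun c : (p * p).-tuple RR => tnth c k).
  exact: measurable_tnth.
split; under eq_fun do rewrite mxE.
  by case: ltngtP => _ /=; exact: mt.
case: ltngtP => _ /=; [exact: mt| |exact: measurable_cst].
by apply: measurableT_comp => //; exact: mt.
Qed.

Lemma herm_hermx p (c : (p * p).-tuple RR) : herm (hermx c).
Proof.
move=> i j; rewrite !mxE.
case: (ltngtP i j) => [||/val_inj ->] //=; rewrite ?opprK ?oppr0//.
Qed.

Lemma has_cint_herm_translate p (A : 'M[R[i]]_p) (f : 'M[R[i]]_p -> R[i]) v : herm A ->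
  has_cint (@herm_lebesgue R p) (fun c => f (hermx c)) v ->
  has_cint (@herm_lebesgue R p) (fun c => f (hermx c - A)) v.
Proof.
move=> hA hf.
(* The real coordinates of [A] in the layout of [hermx]: slots below the diagonal hold the imaginary
   parts of the mirrored entries. *)
pose B : 'M[R]_p := \matrix_(i, j)
  if (i <= j)%N then complex.Re (A i j) else complex.Im (A j i).
pose phi k : RR -> RR := fun t => 1 * t + - mxvec B 0 k.
have mphi k : measurable_fun setT (phi k).
  by apply: measurable_funD => //; exact: measurable_funM.
have phiE k X : measurable X -> leb (phi k @^-1` X) = (1%:E * leb X)%E.
  by move=> mX; rewrite lebesgue_affine// invr1.
have := has_cint_image (measurable_tuple_mapi mphi) (exprn_gt0 _ ltr01)
   (tuple_measure_mapi ltr01 mphi phiE) hf.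
rewrite expr1n mul1r; apply: has_cint_ext => c; congr f.
apply/matrixP => i j; rewrite !mxE !tnth_mktuple /phi !mul1r !mxvecE !mxE.
have hij := hA i j.
case: (ltngtP i j) => [ij|ij|/val_inj e] /=.
- by case: (A i j) => x y; apply: complex_ext.
- rewrite hij; case: (A j i) => x y; apply: complex_ext => //=.
  by rewrite opprB opprK addrC.
- by rewrite e leqnn (herm_diag _ hA); apply: complex_ext => //=; rewrite oppr0 addr0.
Qed.

Definition betac a b : R[i] := cGamma a * cGamma b / cGamma (a + b).

Lemma has_cint_beta a b s : 0 < complex.Re a -> 0 < complex.Re b ->
  has_cint leb (bker a b s) (betac a b * hpow (a + b) s).
Proof.
move=> a0 b0; have [B hB E] := beta_gamma a0 b0.
have G0 : cGamma (a + b) != 0 by apply: cGamma_neq0; rewrite cReD addr_gt0.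
have -> : betac a b = B by rewrite /betac -E mulfK.
exact: has_cint_bker.
Qed.

Definition mxbeta p a b : R[i] := mxGamma p a * mxGamma p b / mxGamma p (a + b).

(** Equivalent to [Re a > p - 1] when [p >= 1], and vacuous at [p = 0], where the inductions on the
    size start. *)
Definition big_re p a := forall i, (i < p)%N -> i%:R < complex.Re a.

Lemma mxGamma_neq0 p a : big_re p a -> mxGamma p a != 0.
Proof.
move=> ha; rewrite /mxGamma mulf_neq0//.
  rewrite -(rmorph0 (real_complex R)) (inj_eq (@complexI R)).
  by rewrite expf_neq0// gt_eqF// pi_gt0.
apply/prodf_neq0 => i _; apply: cGamma_neq0.
by rewrite cReD cReN Re_nat subr_gt0 ha.
Qed.

Lemma mxGammaS p a :
  mxGamma p.+1 a = pi%:C%C ^+ p * cGamma a * mxGamma p (a - 1) :> R[i].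
Proof.
rewrite /mxGamma big_ord_recl subr0.
have -> : \prod_(i < p) cGamma (a - (lift ord0 i)%:R) = \prod_(i < p) cGamma (a - 1 - i%:R).
  by apply: eq_bigr => i _; rewrite lift0 -natr1 opprD addrA addrAC.
have e : (p.+1 * p.+1.-1 = p.*2 + p * p.-1)%N.
  by case: p => //= q; rewrite -muln2 -mulnDr add2n mulnC.
rewrite e halfD odd_double andFb add0n doubleK.
by rewrite exprD rmorphM/= rmorphXn/= -!mulrA; congr (_ * _); rewrite mulrCA.
Qed.

Lemma mxGamma_shift p a : big_re p a ->
  mxGamma p (a + 1) = mxGamma p a * \prod_(i < p) (a - i%:R) :> R[i].
Proof.
move=> ha; rewrite /mxGamma -mulrA -big_split/=; congr (_ * _).
apply: eq_bigr => i _; rewrite addrAC cGammaS; last first.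
  by rewrite cReD cReN Re_nat subr_gt0 ha.
by rewrite mulrC.
Qed.

Lemma rank_one_constE p a : rank_one_const p a = pi%:C%C ^+ p / \prod_(i < p) (a - i%:R).
Proof.
by rewrite /rank_one_const prodf_div prodr_const card_ord.
Qed.

Lemma big_reB p a : big_re p.+1 a -> big_re p (a - 1).
Proof.
move=> ha i ip; have := ha i.+1 ip.
by rewrite -natr1 cReD cReN [complex.Re 1]/=; lra.
Qed.

Lemma big_re_add p a b : big_re p.+1 a -> big_re p.+1 b -> big_re p (a - 1 + (b - 1)).
Proof.
move=> /big_reB ha /big_reB hb i ip; rewrite cReD.
have := ha i ip; have := hb 0%N (leq_ltn_trans (leq0n _) ip); lra.
Qed.

(** The constants of the induction on the size. The rank-one integral raises its parameter by 1, and
    the product that this shift produces in [mxGamma] cancels against the denominators of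
    [rank_one_const]. *)
Lemma mxbetaS p a b : big_re p.+1 a -> big_re p.+1 b ->
  mxbeta p.+1 a b = betac a b * mxbeta p (a - 1) (b - 1) * rank_one_const p (a - 1 + (b - 1)).
Proof.
move=> ha hb; have hab := big_re_add ha hb.
rewrite /mxbeta /betac !mxGammaS rank_one_constE.
have -> : a + b - 1 = a - 1 + (b - 1) + 1 by ring.
rewrite (mxGamma_shift hab).
have n1 := mxGamma_neq0 hab.
have n2 : cGamma (a + b) != 0.
  apply: cGamma_neq0; rewrite cReD addr_gt0//; first exact: (ha 0%N).
  exact: (hb 0%N).
have n3 : \prod_(i < p) (a - 1 + (b - 1) - i%:R) != 0.
  apply/prodf_neq0 => i _; apply/negP => /eqP e.
  have := hab i (ltn_ord i); have /(congr1 (@complex.Re R)) := e.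
  by rewrite cReD cReN Re_nat /=; lra.
have n4 : pi%:C%C ^+ p != 0 :> R[i].
  rewrite expf_neq0// -(rmorph0 (real_complex R)) (inj_eq (@complexI R)).
  by rewrite gt_eqF// pi_gt0.
move: n1 n2 n3 n4.
move: (\prod_(i < p) _) (mxGamma p _) (mxGamma p (a - 1)) (mxGamma p (b - 1))
  (cGamma (a + b)) (cGamma a) (cGamma b) (pi%:C%C ^+ p) => P G1 G2 G3 g1 g2 g3 Q n1 n2 n3 n4.
by field; rewrite n1 n2 n3 n4.
Qed.

Lemma mx_subE p (A B : 'M[R[i]]_p) i j : (A - B) i j = A i j - B i j.
Proof. by rewrite mxE [X in _ + X]mxE. Qed.

(* Conditionally on the first row of the matrix, the Schur complements range
   over all Hermitian matrices of smaller size; what remains is a rank-one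
   integral over the row and a scalar beta integral over the corner. *)
Lemma has_cint_convolution p a b (S : 'M[R[i]]_p) : big_re p a -> big_re p b ->
  has_cint (@herm_lebesgue R p) (fun c => detpow a (hermx c) * detpow b (S - hermx c))
    (mxbeta p a b * detpow (a + b) S).
Proof.
elim: p a b S => [|p IH] a b S ha hb.
  have -> : mxbeta 0 a b * detpow (a + b) S = 1.
    have G0 z : mxGamma 0 z = 1 :> R[i] by rewrite /mxGamma big_ord0 mulr1.
    by rewrite /mxbeta !G0 invr1 !mulr1.
  apply: (has_cint_ext (g := fun=> 1)); first by move=> c; rewrite /= mulr1.
  exact: (has_cint_dirac _ (cmeas_cst 1)).
set s := complex.Re (S ord0 ord0).
pose X x u c : 'M[R[i]]_p.+1 := hermx (assemble (x, (u, c))).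
pose f a b (z : RR * (p.-tuple (RR * RR) * (p * p).-tuple RR)) :=
  detpow a (hermx (assemble z)) * detpow b (S - hermx (assemble z)).
pose S' : 'M[R[i]]_p := \matrix_(i, j) S (lift ord0 i) (lift ord0 j).
(* [A] and [B] are the rank-one terms that the Schur complements of [X] and of [S - X] subtract. *)
pose A x u : 'M[R[i]]_p := x^-1%:C%C *: outer (@vcplx R p u).
pose B x u : 'M[R[i]]_p :=
  (s - x)^-1%:C%C *: outer (fun j => S ord0 (lift ord0 j) - @vcplx R p u j).
have X00 x u c : complex.Re (X x u c ord0 ord0) = x.
  by rewrite /X hermx_assemble unlift_none.
have X0 x u c j : X x u c ord0 (lift ord0 j) = vcplx u j.
  by rewrite /X hermx_assemble unlift_none liftK.
have XS x u c i j : X x u c (lift ord0 i) (lift ord0 j) = hermx c i j.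
  by rewrite /X hermx_assemble !liftK.
have SX00 x u c : complex.Re ((S - X x u c) ord0 ord0) = s - x.
  by rewrite mx_subE cReD cReN X00.
have schurX x u c : schur (X x u c) = hermx c - A x u.
  apply/matrixP => i j; rewrite [LHS]mxE XS !X0 X00 mx_subE [A x u i j]mxE [outer _ i j]mxE fmorphV.
  by congr (_ - _); rewrite mulrC.
have schurSX x u c : schur (S - X x u c) = S' - hermx c - B x u.
  apply/matrixP => i j; rewrite [LHS]mxE SX00 !mx_subE XS !X0.
  rewrite [S' i j]mxE [B x u i j]mxE [outer _ i j]mxE fmorphV.
  by congr (_ - _); rewrite mulrC.
have fE a' b' x u c : f a' b' (x, (u, c)) = bker (a' - p%:R) (b' - p%:R) s x *
    (detpow (a' - 1) (hermx c - A x u) * detpow (b' - 1) (S' - hermx c - B x u)).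
  rewrite -[LHS]/(detpow a' (X x u c) * detpow b' (S - X x u c)).
  rewrite (detpowS a' (X x u c)) (detpowS b' (S - X x u c)) X00 SX00 schurX schurSX /bker.
  exact: mulrACA.
(* After translating the block by [A], its integral is a convolution of smaller size evaluated at
   [E], the sum of the two Schur complements. *)
pose E x u := S' - B x u - A x u.
have inner1 a' b' (ha' : big_re p.+1 a') (hb' : big_re p.+1 b') x u :
    has_cint (@herm_lebesgue R p) (fun c => f a' b' (x, (u, c)))
      (bker (a' - p%:R) (b' - p%:R) s x *
       (mxbeta p (a' - 1) (b' - 1) * detpow (a' - 1 + (b' - 1)) (E x u))).
  apply: (has_cint_ext (fE a' b' x u)); apply: has_cint_scale.
  have hA : herm (A x u).
    by move=> i j; rewrite mxE [in RHS]mxE conjcM conjc_real -herm_outer.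
  have := @has_cint_herm_translate p (A x u)
    (fun Y => detpow (a' - 1) Y * detpow (b' - 1) (E x u - Y)) _ hA
    (IH _ _ (E x u) (big_reB ha') (big_reB hb')).
  apply: has_cint_ext => c; congr (_ * detpow _ _).
  by rewrite /E opprB addrA subrK addrAC.
pose K a b := (s^-1 ^+ p)%:C%C * (mxbeta p (a - 1) (b - 1) *
  (rank_one_const p (a - 1 + (b - 1)) * detpow (a - 1 + (b - 1) + 1) (schur S))).
have inner2 a' b' (ha' : big_re p.+1 a') (hb' : big_re p.+1 b') x :
    has_cint (@vec_lebesgue R p) (fun u => bker (a' - p%:R) (b' - p%:R) s x *
       (mxbeta p (a' - 1) (b' - 1) * detpow (a' - 1 + (b' - 1)) (E x u)))
     (bker a' b' s x * K a' b').
  have [x0|x0] := ltP 0 x; last first.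
    rewrite /bker !(@hpow_le0 _ _ x)// !mul0r.
    by apply: has_cint_ext (has_cint0 _) => u; rewrite !mul0r.
  have [xs|sx] := ltP x s; last first.
    rewrite /bker !(@hpow_le0 _ _ (s - x)) ?subr_le0// !mulr0 !mul0r.
    by apply: has_cint_ext (has_cint0 _) => u; rewrite mul0r.
  have sx0 : 0 < s - x by rewrite subr_gt0.
  have s0 : 0 < s := lt_trans x0 xs.
  set k := s / (x * (s - x)).
  have k0 : 0 < k by rewrite divr_gt0// mulr_gt0.
  pose c0 := Num.sqrt k.
  have c00 : 0 < c0 by rewrite sqrtr_gt0.
  have c0V2 : c0 ^- 2 = x * (s - x) / s by rewrite sqr_sqrtr ?ltW// invf_div.
  pose bb (j : 'I_p) := - (c0%:C%C * ((x / s)%:C%C * S ord0 (lift ord0 j))).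
  have EE u : E x u = schur S - outer (fun j => c0%:C%C * vcplx u j + bb j).
    (* The block cancels in the sum of the Schur complements, so any value of it will do; [point] is
       a placeholder. *)
    have -> : E x u = schur (S - X x u point) + schur (X x u point).
      by rewrite schurX schurSX addrA (addrAC (S' - _)) subrK.
    have := @schur_sum R p S (X x u point); rewrite X00 => -> //; rewrite ?gt_eqF//.
    rewrite -/s -/k -[in k%:C%C](sqr_sqrtr (ltW k0)) -/c0 -outerZ.
    congr (_ - outer _); apply/funext => j.
    by rewrite X0 /bb mulrBr.
  have := @has_cint_vec_affine R p c0 bb
    (fun u => detpow (a' - 1 + (b' - 1)) (schur S - outer u)) _ c00
    (has_cint_rank_one (schur S) (big_re_add ha' hb')).
  move=> /(has_cint_scale (mxbeta p (a' - 1) (b' - 1))).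
  move=> /(has_cint_scale (bker (a' - p%:R) (b' - p%:R) s x)).
  rewrite c0V2 => h.
  (* The Jacobian [(x (s - x) / s)^p] raises both exponents by [p], turning the corner factor into
     the scalar beta kernel of [a'] and [b']; [s^(-p)] is kept in [K]. *)
  have -> : bker a' b' s x * K a' b' = bker (a' - p%:R) (b' - p%:R) s x *
     (mxbeta p (a' - 1) (b' - 1) * (((x * (s - x) / s) ^+ p)%:C%C *
      (rank_one_const p (a' - 1 + (b' - 1)) * detpow (a' - 1 + (b' - 1) + 1) (schur S)))).
    rewrite /K /bker -{1}(subrK p%:R a') -{1}(subrK p%:R b') -!hpow_exp//.
    have -> : ((x * (s - x) / s) ^+ p)%:C%C =
        x%:C%C ^+ p * (s - x)%:C%C ^+ p * (s^-1 ^+ p)%:C%C :> R[i].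
      by rewrite 2!exprMn 2!rmorphM/= !rmorphXn.
    move: (hpow _ x) (hpow _ (s - x)) (mxbeta _ _ _) (rank_one_const _ _ * _) => w1 w2 w3 w4.
    move: (x%:C%C ^+ p) ((s - x)%:C%C ^+ p) ((s^-1 ^+ p)%:C%C) => w5 w6 w7.
    ring.
  by apply: has_cint_ext h => u; rewrite EE.
have mf a' b' : cmeas (fun d : (p.+1 * p.+1).-tuple RR =>
    detpow a' (hermx d) * detpow b' (S - hermx d)).
  apply: cmeasM; apply: cmeas_detpow => i j; first exact: cmeas_hermx.
  rewrite (_ : (fun d => _) = fun d => S i j - hermx d i j); last first.
    by apply/funext => d; rewrite mx_subE.
  by apply: cmeasB; [exact: cmeas_cst|exact: cmeas_hermx].
have normf a' b' z : `|f a' b' z| = f (rpart a') (rpart b') z.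
  by rewrite /f normrM !normr_detpow.
have hrl a' : big_re p.+1 a' -> big_re p.+1 (rpart a') by [].
have massemble := @measurable_assemble R p.
have inner a' b' (ha' : big_re p.+1 a') (hb' : big_re p.+1 b') x :
    has_cint (sfprod (@vec_lebesgue R p) (@herm_lebesgue R p))
      (fun y => f a' b' (x, y)) (bker a' b' s x * K a' b').
  apply: (has_cint_fubini _ (inner1 a' b' ha' hb' x) _ (inner2 a' b' ha' hb' x)
     (inner2 (rpart a') (rpart b') (hrl _ ha') (hrl _ hb') x)).
    apply: (cmeas_comp (mf a' b')); apply: (measurableT_comp massemble).
    exact: measurable_fun_pair.
  move=> u; apply: has_cint_ext (inner1 (rpart a') (rpart b') (hrl _ ha') (hrl _ hb') x u) => c.
  exact: normf.
have outerint a' b' (ha' : big_re p.+1 a') (hb' : big_re p.+1 b') :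
    has_cint leb (fun x => bker a' b' s x * K a' b') (betac a' b' * hpow (a' + b') s * K a' b').
  apply: has_cint_scaler; apply: has_cint_beta; first exact: (ha' 0%N).
  exact: (hb' 0%N).
have -> : mxbeta p.+1 a b * detpow (a + b) S = betac a b * hpow (a + b) s * K a b.
  rewrite mxbetaS// detpowS -/s /K (_ : a + b - 1 = a - 1 + (b - 1) + 1); last by ring.
  have [s0|s0] := ltP 0 s; last by rewrite !(@hpow_le0 _ _ s)// !(mulr0, mul0r).
  (* Here [s^(-p)] lowers the power of [s] to that of the first pivot in [detpow (a + b) S]. *)
  rewrite -{2}(subrK p%:R (a + b)) -hpow_exp// exprVn fmorphV rmorphXn/=.
  have sn : s%:C%C ^+ p != 0 :> R[i].
    rewrite expf_neq0//; by apply: contraTneq s0 => /complexI ->; rewrite ltxx.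
  move: (s%:C%C ^+ p) sn (betac a b) (mxbeta p (a - 1) (b - 1)) (rank_one_const p _) => w wn B1 B2 B3.
  by field.
have := @has_cint_preimage _ _ _ _ _ (@assemble_measure R p) (@herm_lebesgue R p.+1)
  (@assemble R p) massemble 1 ltr01 (@assemble_measureE R p).
rewrite invr1 => h; rewrite -[_ * K a b]mul1r; apply: h; first exact: mf.
apply: (@has_cint_fubini R _ _ _ _ leb (sfprod (@vec_lebesgue R p) (@herm_lebesgue R p))
  (f a b) _ _ _ _ _ (inner a b ha hb) _ (outerint a b ha hb)
  (outerint (rpart a) (rpart b) (hrl _ ha) (hrl _ hb))).
  exact: (cmeas_comp (mf a b) massemble).
move=> x; apply: has_cint_ext (inner (rpart a) (rpart b) (hrl _ ha) (hrl _ hb) x) => y.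
exact: normf.
Qed.

End convolution.

(** * Dirichlet integrals *)

Section dirichlet_integral.
Context {R : realType}.
Local Notation RR := (measurableTypeR R).
Implicit Types (a b : R[i]).

Lemma big_reD p a b : big_re p a -> big_re p b -> big_re p (a + b).
Proof.
move=> ha hb i ip; rewrite cReD; have := ha i ip; have := hb i ip.
by have : 0 <= i%:R :> R by []; lra.
Qed.

Lemma big_re_sum p k (al : 'I_k -> R[i]) b :
  (forall j, big_re p (al j)) -> big_re p b -> big_re p (\sum_j al j + b).
Proof.
elim: k al => [|k IH] al hal hb; first by rewrite big_ord0 add0r.
by rewrite big_ord_recl -addrA; apply: big_reD => //; apply: IH.
Qed.

(** A general [S] is required by the induction: fixing the first matrix [X_1] leaves the same
    integral at [S - X_1], and integrating over [X_1] is one more convolution. The gamma factors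
    telescope. *)
Lemma has_cint_dirichlet p k (al : 'I_k -> R[i]) b (S : 'M[R[i]]_p) :
  (forall j, big_re p (al j)) -> big_re p b ->
  has_cint (@herm_tuple_lebesgue R p k)
    (fun c => (\prod_j detpow (al j) (hermx (tnth c j))) *
      detpow b (S - \sum_j hermx (tnth c j)))
    ((\prod_j mxGamma p (al j)) * mxGamma p b / mxGamma p (\sum_j al j + b) *
     detpow (\sum_j al j + b) S).
Proof.
elim: k al b S => [|k IH] al b S hal hb.
  rewrite !big_ord0 add0r mul1r divff ?mxGamma_neq0// mul1r.
  apply: (has_cint_ext (g := fun=> detpow b S)).
    by move=> c; rewrite !big_ord0 subr0 mul1r.
  exact: (has_cint_dirac _ (cmeas_cst _)).
pose al' (j : 'I_k) := al (lift ord0 j).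
have hal' j : big_re p (al' j) by exact: hal.
have hs := big_re_sum hal' hb.
pose g (al : 'I_k.+1 -> R[i]) b (c : k.+1.-tuple ((p * p).-tuple RR)) :=
  (\prod_j detpow (al j) (hermx (tnth c j))) * detpow b (S - \sum_j hermx (tnth c j)).
have mg : cmeas (g al b).
  have mh j i1 i2 : cmeas (fun c : k.+1.-tuple ((p * p).-tuple RR) => hermx (tnth c j) i1 i2).
    exact: (cmeas_comp (cmeas_hermx i1 i2) (measurable_tnth j)).
  apply: cmeasM; first by apply: cmeas_prod => j; exact: cmeas_detpow.
  apply: cmeas_detpow => i1 i2.
  rewrite (_ : (fun c => _) = fun c => S i1 i2 - \sum_j hermx (tnth c j) i1 i2); last first.
    by apply/funext => c; rewrite mx_subE summxE.
  by apply: cmeasB; [exact: cmeas_cst|exact: cmeas_sum].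
pose C (al : 'I_k.+1 -> R[i]) b := (\prod_j mxGamma p (al (lift ord0 j))) * mxGamma p b /
  mxGamma p (\sum_j al (lift ord0 j) + b).
have inner (al1 : 'I_k.+1 -> R[i]) b1 (h1 : forall j, big_re p (al1 j)) (h2 : big_re p b1) x :
    has_cint (@herm_tuple_lebesgue R p k) (fun c => g al1 b1 (tuple_cons (x, c)))
      (C al1 b1 * (detpow (al1 ord0) (hermx x) *
        detpow (\sum_j al1 (lift ord0 j) + b1) (S - hermx x))).
  have := IH (fun j => al1 (lift ord0 j)) b1 (S - hermx x) (fun j => h1 _) h2.
  move=> /(has_cint_scale (detpow (al1 ord0) (hermx x))); rewrite mulrCA.
  apply: has_cint_ext => c.
  rewrite /g big_ord_recl [\sum_(j < k.+1) _]big_ord_recl /= -mulrA opprD addrA.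
  have t0 : tnth (tuple_cons (x, c)) ord0 = x by [].
  have tS j : tnth (tuple_cons (x, c)) (lift ord0 j) = tnth c j by rewrite /tuple_cons/= tnthS.
  under eq_bigr do rewrite tS.
  by under [\sum_(i < k) _]eq_bigr do rewrite tS; rewrite t0.
have outerint (al1 : 'I_k.+1 -> R[i]) b1 (h1 : forall j, big_re p (al1 j)) (h2 : big_re p b1) :
    has_cint (@herm_lebesgue R p) (fun x => C al1 b1 * (detpow (al1 ord0) (hermx x) *
        detpow (\sum_j al1 (lift ord0 j) + b1) (S - hermx x)))
     (C al1 b1 * (mxbeta p (al1 ord0) (\sum_j al1 (lift ord0 j) + b1) *
        detpow (al1 ord0 + (\sum_j al1 (lift ord0 j) + b1)) S)).
  by apply: has_cint_scale; apply: has_cint_convolution => //; exact: big_re_sum.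
have -> : (\prod_j mxGamma p (al j)) * mxGamma p b / mxGamma p (\sum_j al j + b) *
     detpow (\sum_j al j + b) S =
   C al b * (mxbeta p (al ord0) (\sum_j al (lift ord0 j) + b) *
        detpow (al ord0 + (\sum_j al (lift ord0 j) + b)) S).
  rewrite big_ord_recl [\sum_j al j]big_ord_recl -addrA /C /mxbeta.
  have n1 := mxGamma_neq0 hs.
  have n2 := mxGamma_neq0 (big_reD (hal ord0) hs).
  move: n1 n2; move: (mxGamma p (_ + b)) (mxGamma p (_ + (_ + b))) (detpow _ _)
    (\prod_(i < k) _) (mxGamma p (al ord0)) (mxGamma p b) => w1 w2 w3 w4 w5 w6 n1 n2.
  by field; rewrite n1 n2.
apply: has_cint_tuple_cons; first exact: mg.
pose rlal j := rpart (al j).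
apply: (@has_cint_fubini R _ _ _ _ (@herm_lebesgue R p) (@herm_tuple_lebesgue R p k)
  (fun z => g al b (tuple_cons z)) _ _ _ _ _ (inner al b hal hb) _ (outerint al b hal hb)
  (outerint rlal (rpart b) hal hb)).
  exact: (cmeas_comp mg (@measurable_tuple_cons _ _ k)).
move=> x; apply: has_cint_ext (inner rlal (rpart b) hal hb x) => c.
rewrite /g normrM normr_prod normr_detpow; congr (_ * _).
by apply: eq_bigr => j _; exact: normr_detpow.
Qed.

Lemma schur1 p : schur (1%:M : 'M[R[i]]_p.+1) = 1%:M.
Proof.
apply/matrixP => i j; rewrite !mxE mulr0 mul0r subr0.
by rewrite (inj_eq (@lift_inj _ ord0)).
Qed.

Lemma detpow1 p a : detpow a (1%:M : 'M[R[i]]_p) = 1.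
Proof.
elim: p a => [//|p IH] a; rewrite detpowS schur1 IH mulr1 mxE eqxx.
by rewrite hpow_gt0 ?cpowR1//= ltr01.
Qed.

Lemma qformD p (A B : 'M[R[i]]_p) u : qform (A + B) u = qform A u + qform B u.
Proof.
rewrite /qform -big_split; apply: eq_bigr => i _; rewrite -big_split.
by apply: eq_bigr => j _; rewrite mxE mulrDr mulrDl.
Qed.

Lemma posdefmxD p (A B : 'M[R[i]]_p) : posdefmx A -> posdefmx B -> posdefmx (A + B).
Proof.
move=> /posdefmxE[hA pA] /posdefmxE[hB pB]; apply/posdefmxE; split.
  by move=> i j; rewrite mxE [in RHS]mxE conjcD -hA -hB.
by move=> u u0; rewrite qformD addr_gt0 ?pA ?pB.
Qed.

Lemma posdefmxD_sum p (I : finType) (P : pred I) (A : 'M[R[i]]_p) (X : I -> 'M[R[i]]_p) :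
  posdefmx A -> (forall i, posdefmx (X i)) -> posdefmx (A + \sum_(i | P i) X i).
Proof.
move=> pA pX; elim/big_rec: _ => [|i B _ pB]; first by rewrite addr0.
by rewrite addrCA; exact: posdefmxD.
Qed.

(** Puts the support in the form that a product of [detpow] factors detects, one positivity
    condition per factor. *)
Lemma dirichlet_supportE p k (X : 'I_k -> 'M[R[i]]_p) : dirichlet_support X <->
  (forall j, posdefmx (X j)) /\ posdefmx (1%:M - \sum_j X j).
Proof.
split=> -[h1 h2]; (split; last exact: h2); first by move=> j; have [] := h1 j.
move=> j; split; first exact: h1.
rewrite (_ : 1%:M - X j = 1%:M - \sum_j X j + \sum_(i | i != j) X i).
  exact: posdefmxD_sum.
by rewrite (bigD1 j)//= opprD addrA subrK.
Qed.

(** On the support, [phi_2] and the last factor of the density are powers of the same determinant,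
    so their exponents add. Off the support at least one [detpow] factor is 0. *)
Lemma dirichlet_density_detpow p k (alpha : 'I_k.+1 -> R[i]) delta
    (X : 'I_k -> 'M[R[i]]_p) : (forall j, herm (X j)) ->
  cpowR (absdet (1%:M - \sum_j X j)) delta * dirichlet_density alpha X =
  dirichlet_const p alpha *
    ((\prod_j detpow (alpha (widen_ord (leqnSn k) j)) (X j)) *
     detpow (alpha ord_max + delta) (1%:M - \sum_j X j)).
Proof.
move=> hX.
have hS : herm (1%:M - \sum_j X j).
  move=> i j; rewrite !mx_subE conjcB !summxE; congr (_ - _).
    by rewrite !mxE eq_sym; case: eqP => _; rewrite ?conjc1 ?conjc0.
  by rewrite raddf_sum/=; apply: eq_bigr => l _; exact: hX.
rewrite /dirichlet_density; case: ifPn => [/asboolP/dirichlet_supportE[pX pS]|].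
  rewrite detpowE// ifT; last exact/asboolP.
  rewrite [in RHS](eq_bigr (fun j => cpowR (absdet (X j)) (alpha (widen_ord (leqnSn k) j) - p%:R))); last first.
    by move=> j _; rewrite detpowE// ifT//; exact/asboolP.
  have -> : alpha ord_max + delta - p%:R = delta + (alpha ord_max - p%:R) by rewrite addrAC addrC.
  rewrite (cpowRD _ delta).
  move: (cpowR _ _) (cpowR _ _) (dirichlet_const p alpha) (\prod_j _) => w1 w2 w3 w4.
  by ring.
move=> /asboolPn; rewrite dirichlet_supportE => h; rewrite mulr0.
have [pS|nS] := pselect (posdefmx (1%:M - \sum_j X j)); last first.
  by rewrite (detpowE _ hS) ifF ?mulr0//; exact/asboolPn.
have [j nj] : exists j, ~ posdefmx (X j).
  by apply: contrapT => /forallNP hj; apply: h; split=> // j; exact: contrapT (hj j).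
rewrite (bigD1 j)//= (detpowE _ (hX j)) ifF ?mul0r ?mulr0//.
exact/asboolPn.
Qed.

End dirichlet_integral.

Theorem mainTheorem2 (R : realType) (p k : nat) (hp : (1 <= p)%N) (hk : (1 <= k)%N)
    (alpha : 'I_k.+1 -> R[i]) (delta : R[i])
    (halpha : forall j : 'I_k.+1, p%:R - 1 < complex.Re (alpha j))
    (hdelta : p%:R - 1 < complex.Re (alpha ord_max + delta)) :
  let phi2 := fun X : 'I_k -> 'M[R[i]]_p =>
    cpowR (absdet (1%:M - \sum_(j < k) X j)) delta in
  dirichlet_integrable alpha phi2 /\
  dirichlet_average alpha phi2 =
    mxGamma p (alpha ord_max + delta) / mxGamma p (alpha ord_max) *
    (mxGamma p (\sum_(j < k.+1) alpha j) /
     mxGamma p (\sum_(j < k.+1) alpha j + delta)).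
Proof.
have big (a : R[i]) : p%:R - 1 < complex.Re a -> big_re p a.
  move=> ha i ip; apply: le_lt_trans ha.
  by rewrite lerBrDr natr1 ler_nat.
have ha j : big_re p (alpha j) by exact: big.
have hd := big _ hdelta.
pose al j := alpha (widen_ord (leqnSn k) j).
have hal j : big_re p (al j) by exact: ha.
move=> phi2.
suff : has_cint (@herm_tuple_lebesgue R p k)
   (fun c => phi2 (herm_tuple c) * dirichlet_density alpha (herm_tuple c))
   (mxGamma p (alpha ord_max + delta) / mxGamma p (alpha ord_max) *
    (mxGamma p (\sum_(j < k.+1) alpha j) /
     mxGamma p (\sum_(j < k.+1) alpha j + delta))) by [].
(* The average is a Dirichlet integral at [S = I], where [detpow] is 1, with last parameter
   [alpha ord_max + delta] but with the normalizing constant of [alpha]. *)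
have := has_cint_scale (dirichlet_const p alpha) (has_cint_dirichlet 1%:M hal hd).
rewrite detpow1 mulr1 => h.
have -> : mxGamma p (alpha ord_max + delta) / mxGamma p (alpha ord_max) *
    (mxGamma p (\sum_(j < k.+1) alpha j) / mxGamma p (\sum_(j < k.+1) alpha j + delta)) =
  dirichlet_const p alpha * ((\prod_j mxGamma p (al j)) * mxGamma p (alpha ord_max + delta) /
    mxGamma p (\sum_j al j + (alpha ord_max + delta))).
  rewrite /dirichlet_const big_ord_recr [in X in _ = _ / X * _]big_ord_recr /= -addrA.
  have n1 := mxGamma_neq0 (ha ord_max).
  have n2 := mxGamma_neq0 (big_re_sum hal hd).
  have n3 : \prod_j mxGamma p (al j) != 0 by apply/prodf_neq0 => j _; exact: mxGamma_neq0.
  rewrite -/al; move: n1 n2 n3.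
  move: (mxGamma p (alpha ord_max)) (mxGamma p (_ + (_ + delta))) (\prod_j _)
    (mxGamma p (_ + delta)) (mxGamma p _) => w1 w2 w3 w4 w5 n1 n2 n3.
  by field; rewrite n1 n2 n3.
apply: has_cint_ext h => c.
by rewrite /phi2 dirichlet_density_detpow// => j; exact: herm_hermx.
Qed.
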